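(* Let $\lambda\in\mathbb{Z}$. Then, as right $\mathfrak{sl}_2$-modules, $$H^0\big((j_{!x\cdot z}\Omega_{\mathbb{C}^\times})\otimes_{\mathcal{O}}\mathcal{O}(\lambda)\big)\cong R(\lambda,<),\qquad H^1\big((j_{!x\cdot z}\Omega_{\mathbb{C}^\times})\otimes_{\mathcal{O}}\mathcal{O}(\lambda)\big)=0,$$ $$H^0\big((j_{\cdot x!z}\Omega_{\mathbb{C}^\times})\otimes_{\mathcal{O}}\mathcal{O}(\lambda)\big)\cong R(\lambda,>),\qquad H^1\big((j_{\cdot x!z}\Omega_{\mathbb{C}^\times})\otimes_{\mathcal{O}}\mathcal{O}(\lambda)\big)=0.$$
   Context: Everything is over $\mathbb{C}$; $\mathcal{D}$-modules and $\mathfrak{sl}_2$-modules are right modules. Geometry: $\mathbb{P}^1$ has homogeneous coordinates $[z_0:z_1]$, $x=z_1/z_0$, $z=x^{-1}$, $\mathbb{C}_x=(x\ne\infty)$, $\mathbb{C}_z=(z\neq\infty)$, $\mathbb{C}^\times=\mathbb{C}_x\cap\mathbb{C}_z$; $j:\mathbb{C}^\times\hookrightarrow\mathbb{P}^1$ is the open embedding, $j_\cdot$ the sheaf direct image. $\mathcal{O},\mathcal{D}$ denote the structure sheaf and the sheaf of algebraic differential operators on $\mathbb{P}^1$; the sheaf of volume forms $\Omega_{\mathbb{C}^\times}$ is a right $\mathcal{D}_{\mathbb{C}^\times}$-module with $(x^n dx)\partial_x=-nx^{n-1}dx$. $H^k(\cdot)=H^k(\mathbb{P}^1,\cdot)$.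 For a holonomic right $\mathcal{D}_X$-module $\mathcal{M}$ on a smooth curve $X$, $\mathbb{D}\mathcal{M}=\Omega_X\otimes_{\mathcal{O}_X}\mathcal{E}xt^1_{\mathcal{D}_X}(\mathcal{M},\mathcal{D}_X)$, and $j_!=\mathbb{D}j_\cdot\mathbb{D}$; concretely $j_!\Omega_{\mathbb{C}^\times}|_{\mathbb{C}_x}\cong\mathcal{D}_{\mathbb{C}_x}/\partial_x x\mathcal{D}_{\mathbb{C}_x}$ and $j_!\Omega_{\mathbb{C}^\times}|_{\mathbb{C}_z}\cong\mathcal{D}_{\mathbb{C}_z}/\partial_z z\mathcal{D}_{\mathbb{C}_z}$. The $\mathcal{D}$-module $j_{!x\cdot z}\mathcal{M}$ is obtained by gluing $(j_!\mathcal{M})|_{\mathbb{C}_x}$ and $(j_\cdot\mathcal{M})|_{\mathbb{C}_z}$ along $\mathbb{C}^\times$ (where both restrict to $\mathcal{M}$); similarly $j_{\cdot x!z}\mathcal{M}$ is obtained by gluing $(j_\cdot\mathcal{M})|_{\mathbb{C}_x}$ and $(j_!\mathcal{M})|_{\mathbb{C}_z}$ along $\mathbb{C}^\times$. Twisting: $\mathcal{D}(\lambda)=\mathcal{O}(-\lambda)\otimes_{\mathcal{O}}\mathcal{D}\otimes_{\mathcal{O}}\mathcal{O}(\lambda)$. For a right $\mathcal{D}$-module $\mathcal{M}$, $\mathcal{M}\otimes_{\mathcal{O}}\mathcal{O}(\lambda)$ is a right $\mathcal{D}(\lambda)$-module via $(m\otimes s)(s^{-1}\otimes p\otimes s)=mp\otimes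 s$ for a nowhere vanishing local section $s$ of $\mathcal{O}(\lambda)$. With $z_0^\lambda$ (resp. $z_1^\lambda$) the nowhere vanishing section of $\mathcal{O}(\lambda)$ on $\mathbb{C}_x$ (resp. $\mathbb{C}_z$), there is an algebra map $\mathcal{U}\mathfrak{sl}_2\to H^0(\mathcal{D}(\lambda))$ given by $e\mapsto z_0^{-\lambda}\otimes\partial_x\otimes z_0^{\lambda}=z_1^{-\lambda}\otimes(-z^2\partial_z-\lambda z)\otimes z_1^{\lambda}$, $h\mapsto z_0^{-\lambda}\otimes(-2x\partial_x-\lambda)\otimes z_0^{\lambda}=z_1^{-\lambda}\otimes(2z\partial_z+\lambda)\otimes z_1^{\lambda}$, $f\mapsto z_0^{-\lambda}\otimes(-x^2\partial_x-\lambda x)\otimes z_0^{\lambda}=z_1^{-\lambda}\otimes\partial_z\otimes z_1^{\lambda}$. Through it the cohomology groups of a right $\mathcal{D}(\lambda)$-module (computed e.g. by the Cech complex $\mathcal{F}(\mathbb{C}_x)\oplus\mathcal{F}(\mathbb{C}_z)\to\mathcal{F}(\mathbb{C}^\times)$, $(s_1,s_2)\mapsto s_1|_{\mathbb{C}^\times}-s_2|_{\mathbb{C}^\times}$) are right $\mathfrak{sl}_2$-modules. $\mathfrak{sl}_2$-modules: for $\alpha\in\mathbb{C}$ let $R(\lambda,\alpha)=\mathcal{U}\mathfrak{sl}_2/(h+2\alpha+\lambda,\ ef+(\alpha+\lambda)(\alpha+1))$, the quotient by the right ideal generated by the two elements. $R(\lambda,<)$ denotes the isomorphism class of $R(\lambda,\alpha)$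 for any integer $\alpha$ with $\alpha\le-\lambda$ if $\lambda\ge2$, and $\alpha\le-1$ if $\lambda\le1$. $R(\lambda,>)$ denotes the isomorphism class of $R(\lambda,\alpha)$ for any integer $\alpha$ with $\alpha\ge0$ if $\lambda\ge1$, and $\alpha\ge1-\lambda$ if $\lambda\le0$. (For fixed $\lambda$, the modules in each range are all isomorphic.) *)

(* Defs.v *)
From HB Require Import structures.
From mathcomp Require Import all_boot all_order all_algebra.
From mathcomp Require Import generic_quotient finmap.
From mathcomp Require Import boolp classical_sets functions cardinality fsbigop.
From mathcomp Require Import reals.
From mathcomp Require Import complex.

Set Implicit Arguments.
Unset Strict Implicit.
Unset Printing Implicit Defensive.

Import GRing.Theory.
Local Open Scope ring_scope.
Local Open Scope quotient_scope.

(* Right modules over a ring D are the left modules over the converse ring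
   D^c, so that m . a is (a : D^c) *: m. *)
Notation rmodType D := (lmodType D^c).

Definition mod_iso (R : pzRingType) (M N : lmodType R) : Prop :=
  exists f : {linear M -> N}, bijective f.

Section SubmoduleQuotient.
Variables (R : pzRingType) (V : lmodType R).

Section Submodule.
Variable N : submodClosed V.

Record sub_mod := SubMod { sub_mod_val : V; sub_modP : sub_mod_val \in N }.
HB.instance Definition _ := [isSub for sub_mod_val].
HB.instance Definition _ := [Choice of sub_mod by <:].
HB.instance Definition _ := [SubChoice_isSubLmodule of sub_mod by <:].
End Submodule.

Section Quotient.
Variable N : submodClosed V.

Definition zmod_of_submod : V -> bool := fun x => x \in N.

Fact zmod_of_submod_closed : zmod_closed zmod_of_submod.
Proof.
split=> [|x y Nx Ny]; first exact: (rpred0 N).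
rewrite -scaleN1r; apply: (rpredD (S := N)); first exact: Nx.
by apply: (rpredZ (s := N)).
Qed.

HB.instance Definition _ :=
  GRing.isZmodClosed.Build V zmod_of_submod zmod_of_submod_closed.

Definition zmod_closed_of_submod : zmodClosed V :=
  GRing.ZmodClosed.clone V zmod_of_submod _.

Definition quot_mod := Quotient.quot zmod_closed_of_submod.
HB.instance Definition _ := GRing.Zmodule.on quot_mod.

Definition quot_pi (x : V) : quot_mod := \pi_(Quotient.quot zmod_closed_of_submod) x.

Lemma quot_piE x y : (quot_pi x = quot_pi y) <-> (x - y \in N).
Proof. by split=> [/eqP|h]; [|apply/eqP]; rewrite -Quotient.idealrBE. Qed.

Lemma quot_pi_surj (q : quot_mod) : exists x, quot_pi x = q.
Proof. by exists (repr q); rewrite /quot_pi reprK. Qed.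

Lemma quot_piD : {morph quot_pi : x y / x + y}.
Proof. by move=> x y; rewrite /quot_pi raddfD. Qed.

Definition quot_scale (a : R) (q : quot_mod) : quot_mod :=
  quot_pi (a *: repr q).

Lemma quot_piZ a x : quot_pi (a *: x) = quot_scale a (quot_pi x).
Proof.
apply/quot_piE; rewrite -scalerBr rpredZ //; apply/quot_piE.
by rewrite [RHS]reprK.
Qed.

Fact quot_scaleA a b q : quot_scale a (quot_scale b q) = quot_scale (a * b) q.
Proof.
by have [x <-] := quot_pi_surj q; rewrite -!quot_piZ scalerA.
Qed.

Fact quot_scale1 : left_id 1 quot_scale.
Proof. by move=> q; have [x <-] := quot_pi_surj q; rewrite -quot_piZ scale1r. Qed.

Fact quot_scaleDr : right_distributive quot_scale +%R.
Proof.
move=> a q r; have [x <-] := quot_pi_surj q; have [y <-] := quot_pi_surj r.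
by rewrite -quot_piD -!quot_piZ scalerDr quot_piD.
Qed.

Fact quot_scaleDl q : {morph quot_scale^~ q : a b / a + b}.
Proof.
by move=> a b; have [x <-] := quot_pi_surj q; rewrite -!quot_piZ scalerDl quot_piD.
Qed.

HB.instance Definition _ := GRing.Zmodule_isLmodule.Build R quot_mod
  quot_scaleA quot_scale1 quot_scaleDr quot_scaleDl.

Fact quot_pi_linear : linear quot_pi.
Proof. by move=> a x y; rewrite quot_piD quot_piZ. Qed.
HB.instance Definition _ := GRing.isLinear.Build R V quot_mod _ quot_pi
  quot_pi_linear.
End Quotient.

Section Span.
Variable S : set V.

Definition span : V -> bool := fun x =>
  `[< forall N : submodClosed V, (forall s, S s -> s \in N) -> x \in N >].

Fact span_closed : GRing.submod_closed span.
Proof.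
split=> [|a x y]; rewrite !unfold_in; first by apply/asboolP=> N _; exact: rpred0.
move=> /asboolP Sx /asboolP Sy; apply/asboolP => N SN.
by rewrite rpredD ?rpredZ ?Sx ?Sy.
Qed.

HB.instance Definition _ := GRing.isSubmodClosed.Build R V span span_closed.
Definition span_mod : submodClosed V := GRing.SubmodClosed.clone R V span _.
End Span.
End SubmoduleQuotient.

Section KernelImage.
Variables (R : pzRingType) (U V : lmodType R) (f : {linear U -> V}).

Definition lin_ker : U -> bool := fun x => f x == 0.

Fact lin_ker_closed : GRing.submod_closed lin_ker.
Proof.
split=> [|a x y]; rewrite !unfold_in /lin_ker ?linear0 //.
by move=> /eqP fx /eqP fy; rewrite linearP fx fy scaler0 addr0.
Qed.
HB.instance Definition _ := GRing.isSubmodClosed.Build R U lin_ker lin_ker_closed.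

Definition lin_im : V -> bool := fun y => `[< exists x, f x = y >].

Fact lin_im_closed : GRing.submod_closed lin_im.
Proof.
split=> [|a x y]; rewrite !unfold_in.
  by apply/asboolP; exists 0; rewrite linear0.
move=> /asboolP[u <-] /asboolP[v <-]; apply/asboolP.
by exists (a *: u + v); rewrite linearP.
Qed.
HB.instance Definition _ := GRing.isSubmodClosed.Build R V lin_im lin_im_closed.

Definition kernel : lmodType R := sub_mod (GRing.SubmodClosed.clone R U lin_ker _).
Definition cokernel : lmodType R := quot_mod (GRing.SubmodClosed.clone R V lin_im _).
End KernelImage.
Arguments kernel : simpl never.
Arguments cokernel : simpl never.

Section Restriction.
Variables (R S : pzRingType) (f : {rmorphism R -> S}) (N : lmodType S).

(* Restriction of scalars along f; the argument f only selects the structure *)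
Definition res_scal of {rmorphism R -> S} : Type := N.
Local Notation res := (res_scal f).
HB.instance Definition _ := GRing.Zmodule.on res.

Definition res_scale (a : R) (x : res) : res := f a *: (x : N).

Fact res_scaleA a b x : res_scale a (res_scale b x) = res_scale (a * b) x.
Proof. by rewrite /res_scale scalerA rmorphM. Qed.
Fact res_scale1 : left_id 1 res_scale.
Proof. by move=> x; rewrite /res_scale rmorph1 scale1r. Qed.
Fact res_scaleDr : right_distributive res_scale +%R.
Proof. by move=> a x y; rewrite /res_scale scalerDr. Qed.
Fact res_scaleDl x : {morph res_scale^~ x : a b / a + b}.
Proof. by move=> a b; rewrite /res_scale rmorphD scalerDl. Qed.
HB.instance Definition _ := GRing.Zmodule_isLmodule.Build R res
  res_scaleA res_scale1 res_scaleDr res_scaleDl.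
End Restriction.
Definition res (R S : pzRingType) (f : {rmorphism R -> S}) (N : lmodType S)
  : lmodType R := res_scal N f.
Arguments res : simpl never.

Section Difference.
Variables (R S S' T : pzRingType) (g : {rmorphism R -> S})
  (g' : {rmorphism R -> S'}) (h : {rmorphism S -> T}) (h' : {rmorphism S' -> T}).
Hypothesis hg : forall a, h (g a) = h' (g' a).
Variables (M : lmodType T) (N : lmodType S) (N' : lmodType S').
Variables (u : {linear N -> res h M}) (v : {linear N' -> res h' M}).

Definition res_diff (_ : forall a, h (g a) = h' (g' a))
    (s : (res g N * res g' N')%type) : res g (res h M) :=
  (u s.1 : M) - (v s.2 : M).

Fact res_diff_linear : linear (res_diff hg).
Proof.
move=> a [s1 s2] [t1 t2]; rewrite /res_diff.
have hu : (u (g a *: s1 + t1) : M) = h (g a) *: (u s1 : M) + (u t1 : M).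
  by rewrite linearP.
have hv : (v (g' a *: s2 + t2) : M) = h (g a) *: (v s2 : M) + (v t2 : M).
  by rewrite hg linearP.
transitivity ((u (g a *: s1 + t1) : M) - (v (g' a *: s2 + t2) : M)); first by [].
by rewrite hu hv opprD addrACA -scalerBr.
Qed.
HB.instance Definition _ := GRing.isLinear.Build R (res g N * res g' N')%type
  (res g (res h M)) _ (res_diff hg) res_diff_linear.
Definition res_diff_lin :
  {linear (res g N * res g' N')%type -> res g (res h M)} := res_diff hg.
End Difference.

Section ScalarTwist.
Variables (S T : pzRingType) (h h' : {rmorphism S -> T}) (c : T).
Hypothesis hc : forall a, c * h a = h' a * c.
Variables (M : lmodType T) (N : lmodType S) (v : {linear N -> res h M}).

Definition res_twist (_ : forall a, c * h a = h' a * c) (s : N) : res h' M :=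
  c *: (v s : M).

Fact res_twist_linear : linear (res_twist hc).
Proof.
move=> a s t; rewrite /res_twist.
have hv : (v (a *: s + t) : M) = h a *: (v s : M) + (v t : M).
  by rewrite linearP.
by rewrite hv scalerDr scalerA hc -scalerA.
Qed.
HB.instance Definition _ := GRing.isLinear.Build S N (res h' M) _
  (res_twist hc) res_twist_linear.
Definition res_twist_lin : {linear N -> res h' M} := res_twist hc.
End ScalarTwist.

Section Converse.
Variables (R S : pzRingType).

Definition conv (f : R -> S) : R^c -> S^c := f.
Definition antiop (f : R -> S^c) : R^c -> S := f.

Section Conv.
Variable f : {rmorphism R -> S}.
Fact conv_additive : zmod_morphism (conv f : R^c -> S^c).
Proof. by move=> x y; exact: (rmorphB f). Qed.
Fact conv_multiplicative : monoid_morphism (conv f : R^c -> S^c).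
Proof. by split=> [|x y]; [exact: (rmorph1 f) | exact: (rmorphM f)]. Qed.
HB.instance Definition _ := GRing.isZmodMorphism.Build R^c S^c (conv f) conv_additive.
HB.instance Definition _ := GRing.isMonoidMorphism.Build R^c S^c (conv f)
  conv_multiplicative.
Definition conv_hom : {rmorphism R^c -> S^c} := conv f.
End Conv.

Section Antiop.
Variable f : {rmorphism R -> S^c}.
Fact antiop_additive : zmod_morphism (antiop f : R^c -> S).
Proof. by move=> x y; exact: (rmorphB f). Qed.
Fact antiop_multiplicative : monoid_morphism (antiop f : R^c -> S).
Proof. by split=> [|x y]; [exact: (rmorph1 f) | exact: (rmorphM f)]. Qed.
HB.instance Definition _ := GRing.isZmodMorphism.Build R^c S (antiop f)
  antiop_additive.
HB.instance Definition _ := GRing.isMonoidMorphism.Build R^c S (antiop f)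
  antiop_multiplicative.
Definition antiop_hom : {rmorphism R^c -> S} := antiop f.
End Antiop.
End Converse.

(* Algebras presented by generators and relations: the k-algebra generated by I
   with the relations rel consists of the formal expressions in I modulo the
   smallest congruence that contains rel and the axioms of associative unital
   k-algebras. *)
Section Presentation.
Variables (k : comNzRingType) (I : Type).

Inductive expr : Type :=
  | EGen of I
  | ECst of k
  | EAdd of expr & expr
  | EOpp of expr
  | EMul of expr & expr.

HB.instance Definition _ := gen_eqMixin expr.
HB.instance Definition _ := gen_choiceMixin expr.

Variable rel : expr -> expr -> Prop.

Inductive congr : expr -> expr -> Prop :=
  | congr_rel s t : rel s t -> congr s t
  | congr_refl s : congr s s
  | congr_sym s t : congr s t -> congr t s
  | congr_trans s t u : congr s t -> congr t u -> congr s u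
  | congr_add s s' t t' :
      congr s s' -> congr t t' -> congr (EAdd s t) (EAdd s' t')
  | congr_opp s s' : congr s s' -> congr (EOpp s) (EOpp s')
  | congr_mul s s' t t' :
      congr s s' -> congr t t' -> congr (EMul s t) (EMul s' t')
  | congr_addA s t u : congr (EAdd s (EAdd t u)) (EAdd (EAdd s t) u)
  | congr_addC s t : congr (EAdd s t) (EAdd t s)
  | congr_add0 s : congr (EAdd (ECst 0) s) s
  | congr_addN s : congr (EAdd (EOpp s) s) (ECst 0)
  | congr_mulA s t u : congr (EMul s (EMul t u)) (EMul (EMul s t) u)
  | congr_mul1l s : congr (EMul (ECst 1) s) s
  | congr_mul1r s : congr (EMul s (ECst 1)) s
  | congr_mulDl s t u :
      congr (EMul (EAdd s t) u) (EAdd (EMul s u) (EMul t u))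
  | congr_mulDr s t u :
      congr (EMul s (EAdd t u)) (EAdd (EMul s t) (EMul s u))
  | congr_cstD a b : congr (ECst (a + b)) (EAdd (ECst a) (ECst b))
  | congr_cstM a b : congr (ECst (a * b)) (EMul (ECst a) (ECst b))
  | congr_cstC a s : congr (EMul (ECst a) s) (EMul s (ECst a)).

Definition congrb : simpl_rel expr := [rel s t | `[< congr s t >]].

Fact congrb_equiv : equiv_class_of congrb.
Proof.
split=> [s|s t|t s u] /=; first exact/asboolP/congr_refl.
  by apply/asboolP/asboolP; exact: congr_sym.
by move=> /asboolP st /asboolP tu; apply/asboolP/(congr_trans st tu).
Qed.
Canonical congrb_equiv_rel := EquivRelPack congrb_equiv.
Canonical congrb_encModRel := defaultEncModRel congrb.

Definition palg : Type := {eq_quot congrb}.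
HB.instance Definition _ := Choice.on palg.

Definition pclass (s : expr) : palg := \pi_{eq_quot congrb} s.

Lemma pclassE s t : (pclass s = pclass t) <-> congr s t.
Proof.
split=> [/eqP|st]; first by rewrite eqmodE => /asboolP.
by apply/eqP; rewrite eqmodE; apply/asboolP.
Qed.

Lemma pclass_repr (a : palg) : pclass (repr a) = a.
Proof. by rewrite /pclass; exact: (@reprK _ {eq_quot congrb}). Qed.

Lemma pclass_surj (a : palg) : exists s, pclass s = a.
Proof. by exists (repr a); exact: pclass_repr. Qed.

Lemma repr_pclass s : congr (repr (pclass s)) s.
Proof. by apply/pclassE; exact: pclass_repr. Qed.

Definition padd (a b : palg) := pclass (EAdd (repr a) (repr b)).
Definition popp (a : palg) := pclass (EOpp (repr a)).
Definition pmul (a b : palg) := pclass (EMul (repr a) (repr b)).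

Lemma pclassD s t : pclass (EAdd s t) = padd (pclass s) (pclass t).
Proof. by apply/pclassE/congr_add; apply/congr_sym/repr_pclass. Qed.
Lemma pclassN s : pclass (EOpp s) = popp (pclass s).
Proof. by apply/pclassE/congr_opp; apply/congr_sym/repr_pclass. Qed.
Lemma pclassM s t : pclass (EMul s t) = pmul (pclass s) (pclass t).
Proof. by apply/pclassE/congr_mul; apply/congr_sym/repr_pclass. Qed.

Let pE := (=^~ pclassD, =^~ pclassN, =^~ pclassM).

Fact paddA : associative padd.
Proof.
move=> a b c; have [s <-] := pclass_surj a; have [t <-] := pclass_surj b.
by have [u <-] := pclass_surj c; rewrite !pE; apply/pclassE/congr_addA.
Qed.
Fact paddC : commutative padd.
Proof.
move=> a b; have [s <-] := pclass_surj a; have [t <-] := pclass_surj b.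
by rewrite !pE; apply/pclassE/congr_addC.
Qed.
Fact padd0 : left_id (pclass (ECst 0)) padd.
Proof.
by move=> a; have [s <-] := pclass_surj a; rewrite !pE; apply/pclassE/congr_add0.
Qed.
Fact paddN : left_inverse (pclass (ECst 0)) popp padd.
Proof.
by move=> a; have [s <-] := pclass_surj a; rewrite !pE; apply/pclassE/congr_addN.
Qed.
HB.instance Definition _ := GRing.isZmodule.Build palg paddA paddC padd0 paddN.

Fact pmulA : associative pmul.
Proof.
move=> a b c; have [s <-] := pclass_surj a; have [t <-] := pclass_surj b.
by have [u <-] := pclass_surj c; rewrite !pE; apply/pclassE/congr_mulA.
Qed.
Fact pmul1l : left_id (pclass (ECst 1)) pmul.
Proof.
by move=> a; have [s <-] := pclass_surj a; rewrite !pE; apply/pclassE/congr_mul1l.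
Qed.
Fact pmul1r : right_id (pclass (ECst 1)) pmul.
Proof.
by move=> a; have [s <-] := pclass_surj a; rewrite !pE; apply/pclassE/congr_mul1r.
Qed.
Fact pmulDl : left_distributive pmul padd.
Proof.
move=> a b c; have [s <-] := pclass_surj a; have [t <-] := pclass_surj b.
by have [u <-] := pclass_surj c; rewrite !pE; apply/pclassE/congr_mulDl.
Qed.
Fact pmulDr : right_distributive pmul padd.
Proof.
move=> a b c; have [s <-] := pclass_surj a; have [t <-] := pclass_surj b.
by have [u <-] := pclass_surj c; rewrite !pE; apply/pclassE/congr_mulDr.
Qed.
HB.instance Definition _ := GRing.Zmodule_isPzRing.Build palg
  pmulA pmul1l pmul1r pmulDl pmulDr.

Lemma pclass_add s t : pclass (EAdd s t) = pclass s + pclass t.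
Proof. exact: pclassD. Qed.
Lemma pclass_opp s : pclass (EOpp s) = - pclass s.
Proof. exact: pclassN. Qed.
Lemma pclass_mul s t : pclass (EMul s t) = pclass s * pclass t.
Proof. exact: pclassM. Qed.

Definition gen (i : I) : palg := pclass (EGen i).
Definition pcst (a : k) : palg := pclass (ECst a).

Fact pcst_monoid_morphism : monoid_morphism pcst.
Proof. by split=> [//|a b]; rewrite -pclass_mul; apply/pclassE/congr_cstM. Qed.
Fact pcst_zmod_morphism : zmod_morphism pcst.
Proof.
move=> a b; apply/(addIr (pcst b)); rewrite subrK /pcst.
by rewrite -pclass_add -{2}(subrK b a); apply/pclassE/congr_sym/congr_cstD.
Qed.
HB.instance Definition _ := GRing.isZmodMorphism.Build k palg pcst
  pcst_zmod_morphism.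
HB.instance Definition _ := GRing.isMonoidMorphism.Build k palg pcst
  pcst_monoid_morphism.

Lemma pcstC a b : pcst a * b = b * pcst a.
Proof.
have [s <-] := pclass_surj b; rewrite -!pclass_mul.
by apply/pclassE/congr_cstC.
Qed.

Lemma palg_ind (P : palg -> Prop) :
  (forall i, P (gen i)) -> (forall a, P (pcst a)) ->
  (forall a b, P a -> P b -> P (a + b)) -> (forall a, P a -> P (- a)) ->
  (forall a b, P a -> P b -> P (a * b)) -> forall a, P a.
Proof.
move=> Pg Pc PD PN PM a; have [s <-] := pclass_surj a.
elim: s => [i|c|s IHs t IHt|s IHs|s IHs t IHt]; [exact: Pg|exact: Pc|..].
- by rewrite pclassD; exact: PD.
- by rewrite pclassN; exact: PN.
- by rewrite pclassM; exact: PM.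
Qed.

Lemma palg_rel s t : rel s t -> pclass s = pclass t.
Proof. by move=> st; apply/pclassE/congr_rel. Qed.

Section Lift.
Variables (B : pzRingType) (c : {rmorphism k -> B}) (g : I -> B).

Fixpoint eval (s : expr) : B :=
  match s with
  | EGen i => g i
  | ECst a => c a
  | EAdd s t => eval s + eval t
  | EOpp s => - eval s
  | EMul s t => eval s * eval t
  end.

Hypothesis c_central : forall a i, c a * g i = g i * c a.
Hypothesis eval_rel : forall s t, rel s t -> eval s = eval t.

Fact eval_central a s : c a * eval s = eval s * c a.
Proof.
elim: s => [i|b|s IHs t IHt|s IHs|s IHs t IHt] /=; first exact: c_central.
- by rewrite -!rmorphM mulrC.
- by rewrite mulrDr mulrDl IHs IHt.
- by rewrite mulrN mulNr IHs.
- by rewrite mulrA IHs -mulrA IHt mulrA.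
Qed.

Lemma eval_congr s t : congr s t -> eval s = eval t.
Proof.
elim=> //= {s t}.
- by move=> s t u _ -> _ ->.
- by move=> s s' t t' _ -> _ ->.
- by move=> s s' _ ->.
- by move=> s s' t t' _ -> _ ->.
- by move=> s t u; rewrite addrA.
- by move=> s t; rewrite addrC.
- by move=> s; rewrite rmorph0 add0r.
- by move=> s; rewrite rmorph0 addNr.
- by move=> s t u; rewrite mulrA.
- by move=> s; rewrite rmorph1 mul1r.
- by move=> s; rewrite rmorph1 mulr1.
- by move=> s t u; rewrite mulrDl.
- by move=> s t u; rewrite mulrDr.
- by move=> a b; rewrite rmorphD.
- by move=> a b; rewrite rmorphM.
- by move=> a s; exact: eval_central.
Qed.

Definition palg_lift (_ : forall a i, c a * g i = g i * c a)
    (_ : forall s t, rel s t -> eval s = eval t) (a : palg) : B :=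
  eval (repr a).
Local Notation lift := (palg_lift c_central eval_rel).

Lemma palg_liftE s : lift (pclass s) = eval s.
Proof. by apply/eval_congr/repr_pclass. Qed.

Lemma palg_lift_gen i : lift (gen i) = g i. Proof. exact: palg_liftE. Qed.
Lemma palg_lift_cst a : lift (pcst a) = c a. Proof. exact: palg_liftE. Qed.

Fact palg_lift_zmod : zmod_morphism lift.
Proof.
move=> a b; have [s <-] := pclass_surj a; have [t <-] := pclass_surj b.
by rewrite -pclass_opp -pclass_add !palg_liftE.
Qed.
Fact palg_lift_monoid : monoid_morphism lift.
Proof.
split=> [|a b]; first by rewrite palg_lift_cst rmorph1.
have [s <-] := pclass_surj a; have [t <-] := pclass_surj b.
by rewrite -pclass_mul !palg_liftE.
Qed.
HB.instance Definition _ := GRing.isZmodMorphism.Build palg B lift palg_lift_zmod.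
HB.instance Definition _ := GRing.isMonoidMorphism.Build palg B lift
  palg_lift_monoid.
Definition palg_hom : {rmorphism palg -> B} := lift.
End Lift.

Lemma palg_hom_eq (B : pzRingType) (f g : {rmorphism palg -> B}) :
  (forall i, f (gen i) = g (gen i)) -> (forall a, f (pcst a) = g (pcst a)) ->
  f =1 g.
Proof.
move=> fg fc; apply: palg_ind => [||a b|a|a b]; [exact: fg|exact: fc|..].
- by rewrite !rmorphD => -> ->.
- by rewrite !rmorphN => ->.
- by rewrite !rmorphM => -> ->.
Qed.


(* A right module over a presented algebra is a k-module with operators that
   satisfy the relations, where products act from left to right. *)
Section RightModule.
Variables (V : lmodType k) (g : I -> {linear V -> V}).

Fixpoint act (s : expr) (v : V) : V :=
  match s with
  | EGen i => g i v
  | ECst a => a *: v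
  | EAdd s t => act s v + act t v
  | EOpp s => - act s v
  | EMul s t => act t (act s v)
  end.

Hypothesis act_rel : forall s t, rel s t -> act s =1 act t.

Fact act_linear s : linear (act s).
Proof.
elim: s => [i|b|s IHs t IHt|s IHs|s IHs t IHt] a u v /=.
- by rewrite linearP.
- by rewrite scalerDr !scalerA mulrC.
- by rewrite IHs IHt scalerDr addrACA.
- by rewrite IHs opprD scalerN.
- by rewrite IHs IHt.
Qed.

Lemma actD s : {morph act s : u v / u + v}.
Proof. by move=> u v; rewrite -{1}[u]scale1r act_linear scale1r. Qed.

Lemma act0 s : act s 0 = 0.
Proof. by apply: (addIr (act s 0)); rewrite -actD !add0r. Qed.

Lemma actZ s a : {morph act s : u / a *: u}.
Proof. by move=> u; rewrite -{1}[a *: u]addr0 act_linear act0 addr0. Qed.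

Lemma act_congr s t : congr s t -> act s =1 act t.
Proof.
elim=> //= {s t}.
- by move=> s t _ st v; rewrite st.
- by move=> s t u _ st _ tu v; rewrite st tu.
- by move=> s s' t t' _ ss _ tt v; rewrite ss tt.
- by move=> s s' _ ss v; rewrite ss.
- by move=> s s' t t' _ ss _ tt v; rewrite ss tt.
- by move=> s t u v; rewrite addrA.
- by move=> s t v; rewrite addrC.
- by move=> s v; rewrite scale0r add0r.
- by move=> s v; rewrite addNr scale0r.
- by move=> s v; rewrite scale1r.
- by move=> s v; rewrite scale1r.
- by move=> s t u v; rewrite actD.
- by move=> a b v; rewrite scalerDl.
- by move=> a b v; rewrite scalerA mulrC.
- by move=> a s v; rewrite actZ.
Qed.

Definition pmod_of (_ : forall s t, rel s t -> act s =1 act t) : Type := V.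
Local Notation pmod := (pmod_of act_rel).
HB.instance Definition _ := GRing.Zmodule.on pmod.

Definition pmod_scale (a : palg^c) (v : pmod) : pmod := act (repr (a : palg)) v.

Lemma pmod_scaleE s v : pmod_scale (pclass s) v = act s v.
Proof. by apply/act_congr/repr_pclass. Qed.

Fact pmod_scaleA a b v : pmod_scale a (pmod_scale b v) = pmod_scale (a * b) v.
Proof.
have [s <-] := pclass_surj a; have [t <-] := pclass_surj b.
have -> : (pclass s : palg^c) * (pclass t : palg^c) = pclass (EMul t s).
  by rewrite pclass_mul.
by rewrite !pmod_scaleE.
Qed.
Fact pmod_scale1 : left_id 1 pmod_scale.
Proof. by move=> v; rewrite [LHS]pmod_scaleE /= scale1r. Qed.
Fact pmod_scaleDr : right_distributive pmod_scale +%R.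
Proof. by move=> a u v; exact: actD. Qed.
Fact pmod_scaleDl v : {morph pmod_scale^~ v : a b / a + b}.
Proof.
move=> a b; have [s <-] := pclass_surj a; have [t <-] := pclass_surj b.
by rewrite -[X in pmod_scale X]pclass_add !pmod_scaleE.
Qed.
HB.instance Definition _ := GRing.Zmodule_isLmodule.Build palg^c pmod
  pmod_scaleA pmod_scale1 pmod_scaleDr pmod_scaleDl.
End RightModule.

Definition pmod (V : lmodType k) (g : I -> {linear V -> V})
  (h : forall s t, rel s t -> act g s =1 act g t) : rmodType palg := pmod_of h.

Lemma pmodE (V : lmodType k) (g : I -> {linear V -> V})
    (h : forall s t, rel s t -> act g s =1 act g t) (s : expr) (v : pmod h) :
  (pclass s : palg^c) *: v = act g s v :> V.
Proof. exact: pmod_scaleE. Qed.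

End Presentation.
Arguments pmod : simpl never.

Section FiniteSupport.
Variables (R : pzRingType) (T : choiceType) (V : lmodType R).

Definition finsupp : (T -> V) -> bool :=
  fun u => `[< finite_set [set t | u t != 0] >].

Fact finsupp_closed : GRing.submod_closed finsupp.
Proof.
split=> [|a u v]; rewrite !unfold_in.
  apply/asboolP; apply: (sub_finite_set _ (finite_set0 T)) => t /=.
  by rewrite eqxx.
move=> /asboolP fu /asboolP fv; apply/asboolP.
apply: (@sub_finite_set _ _ ([set t | u t != 0%R] `|` [set t | v t != 0%R])%classic);
  last by rewrite finite_setU.
move=> t /=; apply: contraPP => /not_orP[/negP/negPn/eqP u0 /negP/negPn/eqP v0].
apply/negP/negPn/eqP.
by rewrite -[LHS]/(a *: u t + v t) u0 v0 scaler0 addr0.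
Qed.
HB.instance Definition _ :=
  GRing.isSubmodClosed.Build R (T -> V) finsupp finsupp_closed.

Definition fs_mod : lmodType R :=
  sub_mod (GRing.SubmodClosed.clone R (T -> V) finsupp _).

Definition fs_val (u : fs_mod) : T -> V := sub_mod_val u.

Lemma fs_finite (u : fs_mod) : finite_set [set t | fs_val u t != 0].
Proof. by have := sub_modP u; rewrite unfold_in => /asboolP. Qed.

Lemma fs_valP a (u v : fs_mod) t :
  fs_val (a *: u + v) t = a *: fs_val u t + fs_val v t.
Proof. by []. Qed.

Lemma finsuppP (u : T -> V) : finite_set [set t | u t != 0] ->
  u \in GRing.SubmodClosed.clone R (T -> V) finsupp _.
Proof. by move=> fu; apply/asboolP. Qed.
End FiniteSupport.
Arguments fs_mod : simpl never.

Section Ext.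
Variables (D : pzRingType).

Section Hom.
Variable M : rmodType D.

Definition is_rhom : (M -> D^o) -> bool :=
  fun phi => `[< forall (a : D) (u v : M),
                   phi ((a : D^c) *: u + v) = (phi u : D) * a + phi v >].

Fact is_rhom_closed : GRing.submod_closed is_rhom.
Proof.
split=> [|b p q]; rewrite !unfold_in.
  by apply/asboolP => a u v; rewrite [0 _]/(0 : D) [RHS]addr0 mul0r.
move=> /asboolP hp /asboolP hq; apply/asboolP => a u v.
rewrite -[LHS]/(b * p _ + q _) hp hq.
rewrite -[RHS]/((b * p u + q u) * a + (b * p v + q v)).
by rewrite mulrDr mulrDl mulrA addrACA.
Qed.
HB.instance Definition _ :=
  GRing.isSubmodClosed.Build D (M -> D^o) is_rhom is_rhom_closed.

(* Hom_D(M, D) for a right module M: a left D-module *)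
Definition rhom : lmodType D :=
  sub_mod (GRing.SubmodClosed.clone D (M -> D^o) is_rhom _).
Arguments rhom : simpl never.
Definition rhom_fun (phi : rhom) : M -> D := sub_mod_val phi.

Lemma rhomP (phi : rhom) (a : D) (u v : M) :
  rhom_fun phi ((a : D^c) *: u + v) = rhom_fun phi u * a + rhom_fun phi v.
Proof. by have /asboolP := sub_modP phi; exact. Qed.

Lemma is_rhomP (phi : M -> D) :
  (forall (a : D) (u v : M), phi ((a : D^c) *: u + v) = phi u * a + phi v) ->
  (phi : M -> D^o) \in GRing.SubmodClosed.clone D (M -> D^o) is_rhom _.
Proof. by move=> h; apply/asboolP. Qed.
End Hom.

Section Precomposition.
Variables (M N : rmodType D) (f : {linear M -> N}).

Fact rhom_comp_subproof (phi : rhom N) :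
  (rhom_fun phi \o f : M -> D^o) \in
    GRing.SubmodClosed.clone D (M -> D^o) (@is_rhom M) _.
Proof. by apply: is_rhomP => a u v /=; rewrite linearP rhomP. Qed.

Definition rhom_comp (phi : rhom N) : rhom M := SubMod (rhom_comp_subproof phi).

Fact rhom_comp_linear : linear rhom_comp.
Proof. by move=> a p q; apply: val_inj; apply/funext. Qed.
HB.instance Definition _ := GRing.isLinear.Build D (rhom N) (rhom M) _ rhom_comp
  rhom_comp_linear.
End Precomposition.

Variable M : rmodType D.

(* The free right module on the underlying set of M, and its canonical
   surjection onto M *)
Definition free_cover : rmodType D := fs_mod M (D^c)^o.
Arguments free_cover : simpl never.

Definition augmentation (u : free_cover) : M :=
  \sum_(m \in [set: M]) ((fs_val u m : D^c) *: m).

Lemma augmentationE (A : set M) (u : free_cover) : finite_set A ->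
  ([set m | fs_val u m != 0] `<=` A)%classic ->
  augmentation u = \sum_(m <- fset_set A) ((fs_val u m : D^c) *: m).
Proof.
move=> fA uA; rewrite /augmentation -(@fsbig_widen _ _ _ _ A) //.
  by rewrite fsbig_finite.
move=> m [_ Am] /=; have -> : fs_val u m = 0.
  by apply/eqP/negPn/negP => um; exact/Am/uA.
exact: scale0r.
Qed.

Lemma free_coverP a (u v : free_cover) m :
  fs_val (a *: u + v) m = (a : D^c) * fs_val u m + fs_val v m.
Proof. exact: fs_valP. Qed.

Fact augmentation_linear : linear augmentation.
Proof.
move=> a u v; pose A := ([set m | fs_val u m != 0%R] `|`
  ([set m | fs_val v m != 0%R] `|` [set m | fs_val (a *: u + v) m != 0%R]))%classic.
have fA : finite_set A by rewrite !finite_setU; do ?split; exact: fs_finite.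
rewrite (@augmentationE A u) //; last by move=> m um; left.
rewrite (@augmentationE A v) //; last by move=> m vm; right; left.
rewrite (@augmentationE A (a *: u + v)) //; last by move=> m wm; right; right.
rewrite scaler_sumr -big_split; apply: eq_bigr => m _.
by rewrite free_coverP scalerDl -scalerA.
Qed.
HB.instance Definition _ := GRing.isLinear.Build D^c free_cover M _ augmentation
  augmentation_linear.

Definition syzygies : rmodType D := kernel augmentation.
Arguments syzygies : simpl never.
Definition syzygies_incl : syzygies -> free_cover := @sub_mod_val _ _ _.
Fact syzygies_incl_linear : linear syzygies_incl.
Proof. by []. Qed.
HB.instance Definition _ := GRing.isLinear.Build D^c syzygies free_cover _
  syzygies_incl syzygies_incl_linear.

(* Ext^1_D(M, D), from the exact sequence 0 -> syzygies -> free_cover -> M -> 0,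
   with the left action of D on the target *)
Definition Ext1 : lmodType D := cokernel (rhom_comp syzygies_incl).
End Ext.
Arguments Ext1 : simpl never.

Declare Scope expr_scope.
Delimit Scope expr_scope with E.
Bind Scope expr_scope with expr.
Notation "s + t" := (EAdd s t) : expr_scope.
Notation "- s" := (EOpp s) : expr_scope.
Notation "s - t" := (EAdd s (EOpp t)) : expr_scope.
Notation "s * t" := (EMul s t) : expr_scope.
Notation "a %:E" := (ECst _ a) (at level 2, left associativity, format "a %:E")
  : expr_scope.

Section Algebras.
Variable k : comNzRingType.

(* The Weyl algebra k<t, d | d t = t d + 1>, that is, D on the affine line with
   coordinate t. It is used for both charts of P^1: t = x on C_x, t = z on C_z. *)
Inductive weyl_gen := Wt | Wd.
Local Notation t := (EGen k Wt).
Local Notation d := (EGen k Wd).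
Inductive weyl_rel : expr k weyl_gen -> expr k weyl_gen -> Prop :=
  | weyl_comm : weyl_rel (d * t) (t * d + 1%:E).
Definition weyl : pzRingType := palg weyl_rel.
Arguments weyl : simpl never.
Definition W_t : weyl := gen weyl_rel Wt.
Definition W_d : weyl := gen weyl_rel Wd.

(* D on C^*, generated by x, y = x^-1 and the derivation d = d/dx *)
Inductive tweyl_gen := Lx | Ly | Ld.
Local Notation x := (EGen k Lx).
Local Notation y := (EGen k Ly).
Local Notation dx := (EGen k Ld).
Inductive tweyl_rel : expr k tweyl_gen -> expr k tweyl_gen -> Prop :=
  | tweyl_xy : tweyl_rel (x * y) 1%:E
  | tweyl_yx : tweyl_rel (y * x) 1%:E
  | tweyl_comm : tweyl_rel (dx * x) (x * dx + 1%:E).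
Definition tweyl : pzRingType := palg tweyl_rel.
Arguments tweyl : simpl never.
Definition L_x : tweyl := gen tweyl_rel Lx.
Definition L_y : tweyl := gen tweyl_rel Ly.
Definition L_d : tweyl := gen tweyl_rel Ld.

Inductive sl2_gen := Se | Sh | Sf.
Local Notation e := (EGen k Se).
Local Notation h := (EGen k Sh).
Local Notation f := (EGen k Sf).
Inductive sl2_rel : expr k sl2_gen -> expr k sl2_gen -> Prop :=
  | sl2_ef : sl2_rel (e * f - f * e) h
  | sl2_he : sl2_rel (h * e - e * h) (2%:R%:E * e)
  | sl2_hf : sl2_rel (h * f - f * h) (- (2%:R%:E * f)).
Definition Usl2 : pzRingType := palg sl2_rel.
Arguments Usl2 : simpl never.
Definition U_e : Usl2 := gen sl2_rel Se.
Definition U_h : Usl2 := gen sl2_rel Sh.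
Definition U_f : Usl2 := gen sl2_rel Sf.

Lemma weylE : W_d * W_t = W_t * W_d + 1.
Proof. by have := palg_rel weyl_comm; rewrite pclass_add !pclass_mul. Qed.
Lemma tweyl_xyE : L_x * L_y = 1.
Proof. by have := palg_rel tweyl_xy; rewrite !pclass_mul. Qed.
Lemma tweyl_yxE : L_y * L_x = 1.
Proof. by have := palg_rel tweyl_yx; rewrite !pclass_mul. Qed.
Lemma tweyl_dxE : L_d * L_x = L_x * L_d + 1.
Proof. by have := palg_rel tweyl_comm; rewrite pclass_add !pclass_mul. Qed.
Lemma tweyl_dyE : L_d * L_y = L_y * L_d - L_y * L_y.
Proof.
have := congr1 (fun u => L_y * u * L_y) tweyl_dxE.
rewrite mulrDr mulrDl mulr1 !mulrA tweyl_yxE mul1r => E.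
have {}E : L_y * L_d = L_d * L_y + L_y * L_y by rewrite -E -mulrA tweyl_xyE mulr1.
by rewrite E addrK.
Qed.

(* Restriction of differential operators from C_x to C^*: t = x *)
Definition chart_x_gen (i : weyl_gen) : tweyl :=
  match i with Wt => L_x | Wd => L_d end.
Fact chart_x_central (a : k) i :
  pcst tweyl_rel a * chart_x_gen i = chart_x_gen i * pcst tweyl_rel a.
Proof. exact: pcstC. Qed.
Fact chart_x_rel s u : weyl_rel s u ->
  eval (pcst tweyl_rel) chart_x_gen s = eval (pcst tweyl_rel) chart_x_gen u.
Proof. by case=> /=; rewrite tweyl_dxE rmorph1. Qed.
Definition chart_x : {rmorphism weyl -> tweyl} :=
  palg_hom chart_x_central chart_x_rel.

(* Restriction of differential operators from C_z to C^*: z = x^-1 and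
   d/dz = - x^2 d/dx *)
Definition chart_z_gen (i : weyl_gen) : tweyl :=
  match i with Wt => L_y | Wd => - (L_x * L_x * L_d) end.
Fact chart_z_central (a : k) i :
  pcst tweyl_rel a * chart_z_gen i = chart_z_gen i * pcst tweyl_rel a.
Proof. exact: pcstC. Qed.
Fact chart_z_rel s u : weyl_rel s u ->
  eval (pcst tweyl_rel) chart_z_gen s = eval (pcst tweyl_rel) chart_z_gen u.
Proof.
case=> /=; rewrite rmorph1 mulNr mulrN -(mulrA _ L_d L_y) tweyl_dyE mulrBr opprB !mulrA.
rewrite -(mulrA L_x L_x L_y) tweyl_xyE mulr1 tweyl_xyE tweyl_yxE mul1r.
by rewrite addrC.
Qed.
Definition chart_z : {rmorphism weyl -> tweyl} :=
  palg_hom chart_z_central chart_z_rel.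

(* The transposition anti-automorphisms t -> t, d -> -d, that turn a left
   D-module N into the right D-module Omega (x)_O N: in the frame dt of Omega,
   (dt (x) n) a = dt (x) (a n) for a function a, and
   (dt (x) n) d = - dt (x) (d n). *)
Definition weyl_tr_gen (i : weyl_gen) : weyl^c :=
  match i with Wt => W_t | Wd => - W_d end.
Definition pcst_c (I : Type) (rel : expr k I -> expr k I -> Prop) :
  k -> (palg rel)^c := pcst rel.
Fact pcst_c_zmod I rel : zmod_morphism (@pcst_c I rel).
Proof. exact: (rmorphB (pcst rel)). Qed.
Fact pcst_c_monoid I rel : monoid_morphism (@pcst_c I rel).
Proof.
split=> [|a b]; first exact: (rmorph1 (pcst rel)).
by rewrite mulrC; exact: (rmorphM (pcst rel)).
Qed.
HB.instance Definition _ I rel := GRing.isZmodMorphism.Build k (palg rel)^c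
  (@pcst_c I rel) (@pcst_c_zmod I rel).
HB.instance Definition _ I rel := GRing.isMonoidMorphism.Build k (palg rel)^c
  (@pcst_c I rel) (@pcst_c_monoid I rel).

Fact weyl_tr_central (a : k) i :
  pcst_c weyl_rel a * weyl_tr_gen i = weyl_tr_gen i * pcst_c weyl_rel a.
Proof. by symmetry; exact: (@pcstC _ _ weyl_rel). Qed.
Fact weyl_tr_rel s u : weyl_rel s u ->
  eval (pcst_c weyl_rel) weyl_tr_gen s = eval (pcst_c weyl_rel) weyl_tr_gen u.
Proof.
case=> /=; rewrite rmorph1.
change (W_t * (- W_d) = (- W_d) * W_t + 1 :> weyl).
by rewrite mulrN mulNr weylE opprD addrNK.
Qed.
Definition weyl_tr : {rmorphism weyl -> weyl^c} :=
  palg_hom weyl_tr_central weyl_tr_rel.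

Definition tweyl_tr_gen (i : tweyl_gen) : tweyl^c :=
  match i with Lx => L_x | Ly => L_y | Ld => - L_d end.
Fact tweyl_tr_central (a : k) i :
  pcst_c tweyl_rel a * tweyl_tr_gen i = tweyl_tr_gen i * pcst_c tweyl_rel a.
Proof. by symmetry; exact: (@pcstC _ _ tweyl_rel). Qed.
Fact tweyl_tr_rel s u : tweyl_rel s u ->
  eval (pcst_c tweyl_rel) tweyl_tr_gen s = eval (pcst_c tweyl_rel) tweyl_tr_gen u.
Proof.
case=> /=; rewrite rmorph1.
- exact: tweyl_yxE.
- exact: tweyl_xyE.
- change (L_x * (- L_d) = (- L_d) * L_x + 1 :> tweyl).
  by rewrite mulrN mulNr tweyl_dxE opprD addrNK.
Qed.
Definition tweyl_tr : {rmorphism tweyl -> tweyl^c} :=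
  palg_hom tweyl_tr_central tweyl_tr_rel.

(* Omega (x)_O Ext^1_D(M, D) on an affine curve, with D the ring of global
   differential operators and tr the side change of Omega (x)_O - *)
Definition dual (D : pzRingType) (tr : {rmorphism D -> D^c}) (M : rmodType D) :
  rmodType D := res (antiop_hom tr) (Ext1 M).
Arguments dual : simpl never.

(* For the embedding j of C^* in a chart of P^1, with restriction homomorphism r
   of differential operators, j_. M on the chart is M seen as a module through
   r, and j_! = (dual) j_. (dual). *)
Definition jdot (r : {rmorphism weyl -> tweyl}) (M : rmodType tweyl) :
  rmodType weyl := res (conv_hom r) M.
Arguments jdot : simpl never.
Definition jshriek (r : {rmorphism weyl -> tweyl}) (M : rmodType tweyl) :
  rmodType weyl := dual weyl_tr (jdot r (dual tweyl_tr M)).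
Arguments jshriek : simpl never.

(* Omega on C^*: a finitely supported w : int -> k stands for the form
   \sum_n w(n) x^n dx. *)
Section Omega.
Local Notation forms := (fs_mod int k^o).

Definition wshift_fun (c : int -> k) (s : int) (w : forms) : int -> k :=
  fun n => c n * fs_val w (n + s).

Fact wshift_subproof c s w : (wshift_fun c s w : int -> k^o) \in
  GRing.SubmodClosed.clone k (int -> k^o) (@finsupp k int k^o) _.
Proof.
apply: finsuppP.
apply: (@sub_finite_set _ _
  ((fun m => m - s) @` [set m | fs_val w m != 0%R])%classic); last first.
  exact/finite_image/fs_finite.
move=> n /= wn; exists (n + s); last by rewrite addrK.
by apply: contra wn => /eqP wn; rewrite /wshift_fun wn mulr0.
Qed.

Definition wshift c s (w : forms) : forms := SubMod (wshift_subproof c s w).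

Lemma wshiftE c s w n : fs_val (wshift c s w) n = c n * fs_val w (n + s).
Proof. by []. Qed.

Fact wshift_linear c s : linear (wshift c s).
Proof.
move=> a u v; apply: val_inj; apply/funext => n.
change (c n * (a * fs_val u (n + s) + fs_val v (n + s)) =
  a * (c n * fs_val u (n + s)) + c n * fs_val v (n + s)).
by rewrite mulrDr !mulrA (mulrC a).
Qed.
HB.instance Definition _ c s :=
  GRing.isLinear.Build k forms forms _ (wshift c s) (wshift_linear c s).

(* The right action: (x^n dx) x^{+-1} = x^{n +- 1} dx and
   (x^n dx) d = - n x^{n-1} dx. *)
Definition Omega_act (i : tweyl_gen) : {linear forms -> forms} :=
  match i with
  | Lx => wshift (fun=> 1) (-1)
  | Ly => wshift (fun=> 1) 1
  | Ld => wshift (fun n => - (n + 1)%:~R) 1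
  end.

Fact Omega_rel s u : tweyl_rel s u -> act Omega_act s =1 act Omega_act u.
Proof.
case=> w; apply: val_inj; apply/funext => n.
- change (1 * (1 * fs_val w (n + 1 + -1)) = 1 * fs_val w n).
  by rewrite !mul1r addrK.
- change (1 * (1 * fs_val w (n + -1 + 1)) = 1 * fs_val w n).
  by rewrite !mul1r addrNK.
- change (1 * (- (n + -1 + 1)%:~R * fs_val w (n + -1 + 1)) =
    - (n + 1)%:~R * (1 * fs_val w (n + 1 + -1)) + 1 * fs_val w n).
  by rewrite !mul1r addrNK addrK intrD !mulNr mulrDl mul1r opprD addrNK.
Qed.

Definition Omega : rmodType tweyl := pmod Omega_rel.
Arguments Omega : simpl never.

Lemma Omega_genE i (w : Omega) :
  (gen tweyl_rel i : tweyl^c) *: w = Omega_act i w :> forms.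
Proof. exact: (pmodE (h := Omega_rel)). Qed.
End Omega.
End Algebras.

Section Sl2Identities.
Variables (A : pzRingType) (t d l : A).
Hypotheses (dt : d * t = t * d + 1) (lC : forall a, l * a = a * l).
Let h := - (t * d) *+ 2 - l.
Let f := - (t * t * d) - l * t.

Lemma sl2_identity_ef : d * f - f * d = h.
Proof.
have dttd : d * (t * t * d) = t * t * d * d + (t * d) *+ 2.
  rewrite !mulrA dt !mulrDl -!mulrA mul1r [d * (t * d)]mulrA dt mulrDl mul1r.
  by rewrite mulrDr -addrA !mulrA.
have dlt : d * (l * t) = l * t * d + l.
  by rewrite mulrA -lC -mulrA dt mulrDr mulr1 mulrA.
rewrite /f /h mulrBr mulrN dttd dlt mulrBl mulNr !opprD !opprK.
by rewrite [LHS](AC (2*2*2) ((1*5)*(3*6)*2*4)) /= addNr addNr !add0r.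
Qed.

Lemma sl2_identity_he : h * d - d * h = d *+ 2.
Proof.
rewrite /h mulrBl mulrBr !mulNrn mulNr mulrN !opprD !opprK.
rewrite mulrnAl mulrnAr (mulrA d t d) dt (mulrDl (t * d) 1 d) mul1r mulrnDl lC.
by rewrite [LHS](AC (2*3) (1*3*(2*5)*4)) /= !addNr !add0r.
Qed.

Lemma sl2_identity_hf : h * f - f * h = - (f *+ 2).
Proof.
have tdt : t * d * t = t * (t * d) + t by rewrite -mulrA dt mulrDr mulr1.
pose a := t * d; pose g := t * (a + l).
have -> : f = - g.
  by rewrite /f /g /a mulrDr !mulrA (lC t) opprD.
have -> : h = - (a *+ 2 + l) by rewrite /h opprD mulNrn.
have ga : a * g = g * a + g.
  rewrite /g mulrA tdt -/a mulrDl -(mulrA t a) -(mulrA t (a + l)); congr (t * _ + _).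
  by rewrite mulrDl mulrDr lC.
rewrite !mulNr !mulrN !opprK mulrDl mulrDr lC mulrnAl mulrnAr ga mulrnDl mulNrn.
by rewrite opprK opprD [LHS](AC (3*2) (1*4*(3*5)*2)) /= !subrr !add0r.
Qed.
End Sl2Identities.

Section ProjectiveLine.
Variable k : comNzRingType.
Local Notation weyl := (weyl k).
Local Notation tweyl := (tweyl k).
Local Notation Usl2 := (Usl2 k).
Local Notation W_t := (W_t k).
Local Notation W_d := (W_d k).
Local Notation L_x := (L_x k).
Local Notation L_y := (L_y k).
Local Notation L_d := (L_d k).

(* x^n for n : int *)
Definition L_xpow (n : int) : tweyl :=
  match n with Posz m => L_x ^+ m | Negz m => L_y ^+ m.+1 end.

Lemma L_xpowN n : L_xpow (- n) * L_xpow n = 1.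
Proof.
have yx m : L_y ^+ m * L_x ^+ m = 1.
  by rewrite -exprMn_comm ?tweyl_yxE ?expr1n // /GRing.comm tweyl_yxE tweyl_xyE.
have xy m : L_x ^+ m * L_y ^+ m = 1.
  by rewrite -exprMn_comm ?tweyl_xyE ?expr1n // /GRing.comm tweyl_yxE tweyl_xyE.
by case: n => [[|m]|m]; [rewrite oppr0 mulr1| exact: yx | exact: xy].
Qed.

Lemma L_xpowVN n : L_xpow n * L_xpow (- n) = 1.
Proof. by rewrite -{1}(opprK n) L_xpowN. Qed.

Lemma L_xpow_x n : GRing.comm (L_xpow n) L_x.
Proof.
case: n => m; apply/commr_sym/commrX => //.
by rewrite /GRing.comm tweyl_yxE tweyl_xyE.
Qed.

Lemma L_xpow_y n : GRing.comm (L_xpow n) L_y.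
Proof.
case: n => m; apply/commr_sym/commrX => //.
by rewrite /GRing.comm tweyl_yxE tweyl_xyE.
Qed.

Lemma L_xpow_d n : L_d * L_xpow n = L_xpow n * (L_d + n%:~R * L_y).
Proof.
case: n => m /=.
  elim: m => [|m IHm]; first by rewrite expr0 mulr1 mul1r mul0r addr0.
  rewrite exprSr mulrA IHm -!mulrA; congr (_ * _).
  rewrite -!pmulrn !mulr_natl mulrDl mulrDr mulrnAl mulrnAr.
  by rewrite tweyl_dxE tweyl_yxE tweyl_xyE -addrA mulrS.
have -> : L_d + (Negz m)%:~R * L_y = L_d - L_y *+ m.+1.
  by rewrite NegzE mulrNz mulNr -pmulrn mulr_natl.
elim: m.+1 => [|n IHn]; first by rewrite expr0 mulr1 mul1r mulr0n subr0.
rewrite exprSr mulrA IHn -!mulrA; congr (_ * _).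
by rewrite mulrBl tweyl_dyE mulrBr mulrnAl mulrnAr -addrA -opprD mulrS.
Qed.

(* The sections z_0^lambda on C_x and z_1^lambda = x^lambda z_0^lambda on C_z
   trivialize O(lambda). In these frames sections of D(lambda) are sections of
   D on both charts, and the transition homomorphism on C^* is
   P |-> x^-lambda P x^lambda. *)
Definition chart_zt_fun (lambda : int) (P : weyl) : tweyl :=
  L_xpow (- lambda) * chart_z k P * L_xpow lambda.
Fact chart_zt_zmod lambda : zmod_morphism (chart_zt_fun lambda).
Proof. by move=> P Q; rewrite /chart_zt_fun rmorphB mulrBr mulrBl. Qed.
Fact chart_zt_monoid lambda : monoid_morphism (chart_zt_fun lambda).
Proof.
split=> [|P Q]; rewrite /chart_zt_fun; first by rewrite rmorph1 mulr1 L_xpowN.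
rewrite rmorphM !mulrA; congr (_ * _ * _).
by rewrite -(mulrA _ (L_xpow lambda)) L_xpowVN mulr1.
Qed.
HB.instance Definition _ lambda := GRing.isZmodMorphism.Build weyl tweyl
  (chart_zt_fun lambda) (chart_zt_zmod lambda).
HB.instance Definition _ lambda := GRing.isMonoidMorphism.Build weyl tweyl
  (chart_zt_fun lambda) (chart_zt_monoid lambda).
Definition chart_zt (lambda : int) : {rmorphism weyl -> tweyl} :=
  chart_zt_fun lambda.

(* A D-linear map that exhibits M on C^* as the restriction of the module N on
   an affine chart with coordinate t, that is, as the localization N[t^-1]. *)
Record restriction_map (r : {rmorphism weyl -> tweyl}) (N : rmodType weyl)
    (M : rmodType tweyl) := RestrictionMap {
  restr :> {linear N -> jdot r M};
  restr_ker : forall n, restr n = 0 -> exists i, (W_t ^+ i : weyl^c) *: n = 0;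
  restr_surj : forall m : M,
    exists (n : N) (i : nat), restr n = (r (W_t ^+ i) : tweyl^c) *: m :> M }.

(* Quasi-coherent right modules on P^1 given by gluing modules on C_x and C_z
   along C^*: over D if rz = chart_z, and over D(lambda) (in the frames above)
   if rz = chart_zt lambda. *)
Record glued_mod (rz : {rmorphism weyl -> tweyl}) := Glue {
  sec_x : rmodType weyl;
  sec_z : rmodType weyl;
  sec_xz : rmodType tweyl;
  restr_x : restriction_map (chart_x k) sec_x sec_xz;
  restr_z : restriction_map rz sec_z sec_xz }.

Notation Dmod := (glued_mod (chart_z k)).
Notation Dmod_tw lambda := (glued_mod (chart_zt lambda)).

Section Twist.
Variables (lambda : int) (M : Dmod).

Fact twist_comm (P : weyl) :
  (L_xpow lambda : tweyl^c) * chart_z k P =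
  (chart_zt lambda P : tweyl^c) * L_xpow lambda.
Proof.
change (chart_z k P * L_xpow lambda = L_xpow lambda * chart_zt_fun lambda P).
by rewrite /chart_zt_fun !mulrA L_xpowVN mul1r.
Qed.

(* s |-> s x^lambda *)
Definition twist_restr_z :
    {linear sec_z M -> jdot (chart_zt lambda) (sec_xz M)} :=
  res_twist_lin (h := conv_hom (chart_z k)) (h' := conv_hom (chart_zt lambda))
    twist_comm (restr_z M).

Lemma twist_restr_zE s :
  twist_restr_z s = (L_xpow lambda : tweyl^c) *: (restr_z M s : sec_xz M)
  :> sec_xz M.
Proof. by []. Qed.

Lemma twistK (m : sec_xz M) :
  (L_xpow lambda : tweyl^c) *: ((L_xpow (- lambda) : tweyl^c) *: m) = m.
Proof.
rewrite scalerA; have -> : (L_xpow lambda : tweyl^c) * L_xpow (- lambda) = 1.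
  exact: L_xpowN.
exact: scale1r.
Qed.

Lemma twistVK (m : sec_xz M) :
  (L_xpow (- lambda) : tweyl^c) *: ((L_xpow lambda : tweyl^c) *: m) = m.
Proof.
rewrite scalerA; have -> : (L_xpow (- lambda) : tweyl^c) * L_xpow lambda = 1.
  exact: L_xpowVN.
exact: scale1r.
Qed.

Fact twist_ker s : twist_restr_z s = 0 ->
  exists i, (W_t ^+ i : weyl^c) *: s = 0.
Proof.
move=> s0; apply: (@restr_ker _ _ _ (restr_z M)).
by rewrite -[LHS]twistVK -twist_restr_zE s0 (scaler0 (sec_xz M)).
Qed.

Fact twist_surj (m : sec_xz M) : exists (s : sec_z M) (i : nat),
  twist_restr_z s = (chart_zt lambda (W_t ^+ i) : tweyl^c) *: m :> sec_xz M.
Proof.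
have [s [i si]] := restr_surj (restr_z M) ((L_xpow (- lambda) : tweyl^c) *: m).
exists s, i; rewrite twist_restr_zE si scalerA.
by rewrite (twist_comm (W_t ^+ i)) -scalerA twistK.
Qed.

(* M (x)_O O(lambda): s_x (x) z_0^lambda and s_z (x) z_1^lambda are written
   s_x and s_z; on C^*, s_z (x) z_1^lambda = s_z x^lambda (x) z_0^lambda. *)
Definition twist : Dmod_tw lambda :=
  Glue (restr_x M) (RestrictionMap twist_ker twist_surj).
End Twist.

(* The images in the frames of the two charts of the map U(sl_2) -> H^0(D(lambda));
   they agree on C^* by sl2_compat. *)
Definition sl2_x_gen (lambda : int) (i : sl2_gen) : weyl :=
  match i with
  | Se => W_d
  | Sh => - (W_t * W_d) *+ 2 - lambda%:~R
  | Sf => - (W_t * W_t * W_d) - lambda%:~R * W_t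
  end.
Definition sl2_z_gen (lambda : int) (i : sl2_gen) : weyl :=
  match i with
  | Se => - (W_t * W_t * W_d) - lambda%:~R * W_t
  | Sh => (W_t * W_d) *+ 2 + lambda%:~R
  | Sf => W_d
  end.

Fact sl2_x_central lambda (a : k) i :
  pcst (@weyl_rel k) a * sl2_x_gen lambda i =
  sl2_x_gen lambda i * pcst (@weyl_rel k) a.
Proof. exact: pcstC. Qed.
Fact sl2_z_central lambda (a : k) i :
  pcst (@weyl_rel k) a * sl2_z_gen lambda i =
  sl2_z_gen lambda i * pcst (@weyl_rel k) a.
Proof. exact: pcstC. Qed.

Let intC (n : int) (a : weyl) : n%:~R * a = a * n%:~R.
Proof. by rewrite mulrzl mulrzr. Qed.

Fact sl2_x_rel lambda s u : sl2_rel s u ->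
  eval (pcst (@weyl_rel k)) (sl2_x_gen lambda) s =
  eval (pcst (@weyl_rel k)) (sl2_x_gen lambda) u.
Proof.
have dt := weylE k; have lC := intC lambda.
case=> /=; rewrite ?rmorphMn ?rmorph_nat ?mulr_natl.
- exact: sl2_identity_ef.
- exact: sl2_identity_he.
- exact: sl2_identity_hf.
Qed.
Definition sl2_x lambda : {rmorphism Usl2 -> weyl} :=
  palg_hom (sl2_x_central lambda) (@sl2_x_rel lambda).

Fact sl2_z_rel lambda s u : sl2_rel s u ->
  eval (pcst (@weyl_rel k)) (sl2_z_gen lambda) s =
  eval (pcst (@weyl_rel k)) (sl2_z_gen lambda) u.
Proof.
have dt := weylE k; have lC := intC lambda.
have hE : (W_t * W_d) *+ 2 + lambda%:~R = - (- (W_t * W_d) *+ 2 - lambda%:~R).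
  by rewrite opprB mulNrn opprK addrC.
case=> /=; rewrite ?rmorph_nat ?mulr_natl hE.
- by rewrite -[LHS]opprB (sl2_identity_ef dt lC).
- by rewrite mulNr mulrN -opprD (sl2_identity_hf dt lC) opprK.
- by rewrite mulNr mulrN -opprD (sl2_identity_he dt lC).
Qed.
Definition sl2_z lambda : {rmorphism Usl2 -> weyl} :=
  palg_hom (sl2_z_central lambda) (@sl2_z_rel lambda).

Lemma chart_x_t : chart_x k W_t = L_x. Proof. exact: palg_lift_gen. Qed.
Lemma chart_x_d : chart_x k W_d = L_d. Proof. exact: palg_lift_gen. Qed.
Lemma chart_z_t : chart_z k W_t = L_y. Proof. exact: palg_lift_gen. Qed.
Lemma chart_z_d : chart_z k W_d = - (L_x * L_x * L_d).
Proof. exact: palg_lift_gen. Qed.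
Lemma chart_ztE lambda P :
  chart_zt lambda P = L_xpow (- lambda) * chart_z k P * L_xpow lambda.
Proof. by []. Qed.

Lemma chart_zt_t lambda : chart_zt lambda W_t = L_y.
Proof. by rewrite chart_ztE chart_z_t -mulrA -L_xpow_y mulrA L_xpowN mul1r. Qed.

Lemma chart_zt_d lambda :
  chart_zt lambda W_d = - (L_x * L_x * L_d) - lambda%:~R * L_x.
Proof.
have xxC : L_xpow (- lambda) * (L_x * L_x) = L_x * L_x * L_xpow (- lambda).
  by rewrite mulrA L_xpow_x -mulrA L_xpow_x mulrA.
rewrite chart_ztE chart_z_d mulrN mulNr -[RHS]opprD; congr (- _).
rewrite mulrA xxC -!mulrA L_xpow_d (mulrA (L_xpow (- lambda))) L_xpowN mul1r.
by rewrite !mulrDr !mulrzl !mulrzAr tweyl_xyE mulr1.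
Qed.

Lemma sl2_x_genE lambda i :
  sl2_x lambda (gen (@sl2_rel k) i) = sl2_x_gen lambda i.
Proof. exact: palg_lift_gen. Qed.
Lemma sl2_z_genE lambda i :
  sl2_z lambda (gen (@sl2_rel k) i) = sl2_z_gen lambda i.
Proof. exact: palg_lift_gen. Qed.
Lemma sl2_x_cst lambda a :
  sl2_x lambda (pcst (@sl2_rel k) a) = pcst (@weyl_rel k) a.
Proof. exact: palg_lift_cst. Qed.
Lemma sl2_z_cst lambda a :
  sl2_z lambda (pcst (@sl2_rel k) a) = pcst (@weyl_rel k) a.
Proof. exact: palg_lift_cst. Qed.
Lemma chart_x_cst a : chart_x k (pcst (@weyl_rel k) a) = pcst (@tweyl_rel k) a.
Proof. exact: palg_lift_cst. Qed.
Lemma chart_zt_cst lambda a :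
  chart_zt lambda (pcst (@weyl_rel k) a) = pcst (@tweyl_rel k) a.
Proof.
have -> : chart_zt lambda (pcst (@weyl_rel k) a) =
    L_xpow (- lambda) * pcst (@tweyl_rel k) a * L_xpow lambda.
  by rewrite chart_ztE; congr (_ * _ * _); exact: palg_lift_cst.
rewrite -mulrA (pcstC a (L_xpow lambda : palg (@tweyl_rel k))).
by rewrite mulrA L_xpowN mul1r.
Qed.

Lemma sl2_compat lambda u :
  chart_x k (sl2_x lambda u) = chart_zt lambda (sl2_z lambda u).
Proof.
pose F : {rmorphism Usl2 -> tweyl} := chart_x k \o sl2_x lambda.
pose G : {rmorphism Usl2 -> tweyl} := chart_zt lambda \o sl2_z lambda.
apply: (palg_hom_eq (f := F) (g := G)) => [i|a]; last first.
  change (chart_x k (sl2_x lambda (pcst (@sl2_rel k) a)) =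
    chart_zt lambda (sl2_z lambda (pcst (@sl2_rel k) a))).
  by rewrite sl2_x_cst sl2_z_cst chart_x_cst chart_zt_cst.
change (chart_x k (sl2_x lambda (gen (@sl2_rel k) i)) =
  chart_zt lambda (sl2_z lambda (gen (@sl2_rel k) i))).
rewrite sl2_x_genE sl2_z_genE.
have yxx : L_y * (L_x * L_x) = L_x by rewrite mulrA tweyl_yxE mul1r.
have ytd : L_y * chart_zt lambda W_d = - (L_x * L_d) - lambda%:~R.
  rewrite chart_zt_d mulrBr mulrN mulrA yxx; congr (_ - _).
  by rewrite mulrzl mulrzAr tweyl_yxE.
case: i; rewrite /sl2_x_gen /sl2_z_gen.
- rewrite chart_x_d rmorphB rmorphN !rmorphM rmorph_int chart_zt_t -mulrA ytd.
  rewrite mulrBr mulrN mulrA tweyl_yxE mul1r opprB opprK.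
  by rewrite mulrzl mulrzr addrAC subrr add0r.
- rewrite !rmorphB rmorphD !rmorphMn !rmorphN !rmorphM !rmorph_int.
  rewrite chart_x_t chart_x_d chart_zt_t ytd mulrnBl -[RHS]addrA; congr (_ + _).
  by rewrite mulr2n opprD addrNK.
- rewrite chart_zt_d !rmorphB rmorphN !rmorphM rmorph_int chart_x_t chart_x_d.
  by [].
Qed.

(* The Cech complex of the cover of P^1 by C_x and C_z *)
Section Cohomology.
Variables (lambda : int) (F : Dmod_tw lambda).

Definition cech_x : rmodType Usl2 := res (conv_hom (sl2_x lambda)) (sec_x F).
Definition cech_z : rmodType Usl2 := res (conv_hom (sl2_z lambda)) (sec_z F).
Definition cech_xz : rmodType Usl2 :=
  res (conv_hom (sl2_x lambda)) (jdot (chart_x k) (sec_xz F)).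

Definition cech_diff : {linear (cech_x * cech_z)%type -> cech_xz} :=
  res_diff_lin (g := conv_hom (sl2_x lambda)) (g' := conv_hom (sl2_z lambda))
    (h := conv_hom (chart_x k)) (h' := conv_hom (chart_zt lambda))
    (sl2_compat lambda) (restr_x F) (restr_z F).

Lemma cech_diffE (s : cech_x) (t : cech_z) :
  cech_diff (s, t) = (restr_x F s : sec_xz F) - (restr_z F t : sec_xz F)
  :> sec_xz F.
Proof. by []. Qed.

Definition H0 : rmodType Usl2 := kernel cech_diff.
Definition H1 : rmodType Usl2 := cokernel cech_diff.
End Cohomology.

(* The module j_. M on a chart restricts to M on C^* by the identity. *)
Section JdotRestriction.
Variables (r : {rmorphism weyl -> tweyl}) (M : rmodType tweyl).
Definition jdot_id (m : jdot r M) : jdot r M := m.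
Fact jdot_id_linear : linear jdot_id. Proof. by []. Qed.
HB.instance Definition _ := GRing.isLinear.Build weyl^c (jdot r M) (jdot r M) _
  jdot_id jdot_id_linear.
Fact jdot_id_ker m : jdot_id m = 0 -> exists i, (W_t ^+ i : weyl^c) *: m = 0.
Proof. by move=> m0; exists 0; rewrite expr0 scale1r. Qed.
Fact jdot_id_surj (m : M) : exists (n : jdot r M) (i : nat),
  jdot_id n = (r (W_t ^+ i) : tweyl^c) *: m :> M.
Proof.
by exists m, 0%N; rewrite expr0 rmorph1 (scale1r (m : M)).
Qed.
Definition jdot_restr : restriction_map r (jdot r M) M :=
  RestrictionMap jdot_id_ker jdot_id_surj.
End JdotRestriction.

(* The gluing data of j_{!x.z} Omega and j_{.x!z} Omega: an identification of
   the restriction of j_! Omega to C^* with Omega. Any two of them differ by an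
   automorphism of Omega, that is, by a nonzero scalar, so that the glued module
   does not depend on the choice up to isomorphism. *)
Definition shriek_gluing (r : {rmorphism weyl -> tweyl}) :=
  restriction_map r (jshriek r (Omega k)) (Omega k).
Definition jshriekx_dotz (rho : shriek_gluing (chart_x k)) : Dmod :=
  Glue rho (jdot_restr (chart_z k) (Omega k)).
Definition jdotx_shriekz (rho : shriek_gluing (chart_z k)) : Dmod :=
  Glue (jdot_restr (chart_x k) (Omega k)) rho.

(* These are kept apart from R_rels so that the product is that of Usl2, not of
   Usl2^c. *)
Definition R_rel_h (lambda : int) (alpha : k) : Usl2 :=
  U_h k + pcst (@sl2_rel k) (2%:R * alpha + lambda%:~R).
Definition R_rel_ef (lambda : int) (alpha : k) : Usl2 :=
  U_e k * U_f k + pcst (@sl2_rel k) ((alpha + lambda%:~R) * (alpha + 1)).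
Definition R_rels (lambda : int) (alpha : k) : set (Usl2^c)^o :=
  [set R_rel_h lambda alpha; R_rel_ef lambda alpha]%classic.

(* R(lambda, alpha): the quotient of Usl2, as a right module over itself, by the
   submodule (right ideal) generated by R_rels. *)
Definition Rmod (lambda : int) (alpha : k) : rmodType Usl2 :=
  quot_mod (span_mod (R_rels lambda alpha)).
End ProjectiveLine.
Arguments H0 : simpl never.
Arguments H1 : simpl never.
Arguments Rmod : simpl never.

(* The integers alpha for which R(lambda, alpha) is R(lambda, <), resp.
   R(lambda, >) *)
Definition range_lt (lambda alpha : int) : bool :=
  if 2 <= lambda then alpha <= - lambda else alpha <= - 1.
Definition range_gt (lambda alpha : int) : bool :=
  if 1 <= lambda then 0 <= alpha else 1 - lambda <= alpha.

(* Main.v *)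
Require Import Defs.
From HB Require Import structures.
From mathcomp Require Import all_boot all_order all_algebra finmap.
From mathcomp Require Import boolp classical_sets functions cardinality.
From mathcomp Require Import reals complex ring zify.

(** On either chart, with coordinate [t] and derivation [d], [Omega] on C^* has
    a basis [e_n] ([n] an integer) with [e_n t = e_(n+1)], [e_n d = -n e_(n-1)], so
    that [j_. Omega] is generated by [e_(-1)], with annihilator [(td)D].  For a
    left regular [a], [Ext^1(D/aD, D) = D/Da]; applied twice, this gives
    [j_! Omega = D/(dt)D], with basis [t^n] ([n >= 0]) and [d^(-n)] ([n < 0]).
    One of the two restriction maps of the Cech complex is bijective, hence [H^1]
    vanishes and [H^0] is [D/(dt)D], seen as an sl_2-module whose weight spaces
    are the lines spanned by the basis vectors [e_m].  The vector of weight
    [-(2 alpha + lambda)] is [e_m] with [m = -alpha-1], resp.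
    [m = alpha+lambda-1]; the range of [alpha] says that [m >= 0] and
    [m >= lambda-1], that is, that no coefficient vanishes on the way up or down
    from [e_m].  So [e_m] generates, and its annihilator is the right ideal of
    R(lambda, alpha), because modulo that ideal U(sl_2) is spanned by the powers
    of [e] and of [f]. *)

Set Implicit Arguments.
Unset Strict Implicit.
Unset Printing Implicit Defensive.

Import Order.TTheory GRing.Theory Num.Theory.
Local Open Scope ring_scope.

(** * Free modules, cyclic modules and Ext^1 *)

Section FreeModule.
Variables (R : pzRingType) (T : choiceType).
Local Notation free := (fs_mod T R^o).

Definition fs_coef (u : free) : T -> R := fs_val u.

Definition fs_supp (u : free) : {fset T} := fset_set [set t | fs_coef u t != 0].

Lemma in_fs_supp (u : free) t : (t \in fs_supp u) = (fs_coef u t != 0).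
Proof.
rewrite in_fset_set; last exact: fs_finite.
by apply/idP/idP; rewrite inE.
Qed.

Lemma fs_coef_inj (u v : free) : fs_coef u =1 fs_coef v -> u = v.
Proof. by move=> uv; apply: val_inj; apply/funext. Qed.

Lemma fs_coefD (u v : free) t : fs_coef (u + v) t = fs_coef u t + fs_coef v t.
Proof. by []. Qed.

Lemma fs_coefZ a (u : free) t : fs_coef (a *: u) t = a * fs_coef u t.
Proof. by []. Qed.

Lemma fs_coef0 t : fs_coef (0 : free) t = 0.
Proof. by []. Qed.

Lemma fs_coef_sum (J : Type) (s : seq J) (F : J -> free) t :
  fs_coef (\sum_(j <- s) F j) t = \sum_(j <- s) fs_coef (F j) t.
Proof. by elim: s => [|j s IHs]; rewrite ?big_nil ?big_cons ?fs_coefD ?IHs. Qed.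

Fact fs_delta_subproof t : ((fun s => (s == t)%:R) : T -> R^o) \in
  GRing.SubmodClosed.clone R (T -> R^o) (@Defs.finsupp R T R^o) _.
Proof.
apply: Defs.finsuppP; apply: (sub_finite_set _ (finite_set1 t)) => s /=.
by case: (s =P t) => //; rewrite eqxx.
Qed.
Definition fs_delta t : free := SubMod (fs_delta_subproof t).

Lemma fs_deltaE t s : fs_coef (fs_delta t) s = (s == t)%:R.
Proof. by []. Qed.

Lemma fs_decomp (u : free) :
  u = \sum_(t <- fs_supp u) fs_coef u t *: fs_delta t.
Proof.
apply: fs_coef_inj => t; rewrite fs_coef_sum.
have [tu|tu] := boolP (t \in fs_supp u).
  rewrite (big_fsetD1 t) // fs_coefZ fs_deltaE eqxx mulr1 big1_fset.
    exact/esym/addr0.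
  move=> s; rewrite !inE => /andP[st _] _.
  by rewrite fs_coefZ fs_deltaE eq_sym (negPf st) mulr0.
rewrite big1_fset => [|s su _].
  by apply/eqP; move: tu; rewrite in_fs_supp negbK.
rewrite fs_coefZ fs_deltaE; case: eqP => [ts|]; last by rewrite mulr0.
by rewrite ts su in tu.
Qed.

Section Extension.
Variables (S : pzRingType) (f : {rmorphism R -> S}).
Variables (V : lmodType S) (g : T -> V).

(** The extension is semilinear along [f]. It serves the free cover of a module, with [f] the
    identity, and coordinate spaces over [k] mapped to a module over an algebra, with [f] the
    inclusion of the scalars. *)
Definition fs_ext (u : free) : V :=
  \sum_(t <- fs_supp u) f (fs_coef u t) *: g t.

Lemma fs_ext_wide (A : {fset T}) u : (fs_supp u `<=` A)%fset ->
  fs_ext u = \sum_(t <- A) f (fs_coef u t) *: g t.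
Proof.
move=> uA; apply: big_fset_incl => // t _; rewrite in_fs_supp negbK => /eqP ->.
by rewrite rmorph0 scale0r.
Qed.

Lemma fs_extP a u v : fs_ext (a *: u + v) = f a *: fs_ext u + fs_ext v.
Proof.
pose A := (fs_supp u `|` (fs_supp v `|` fs_supp (a *: u + v)))%fset.
have uA : (fs_supp u `<=` A)%fset by exact: fsubsetUl.
have vA : (fs_supp v `<=` A)%fset.
  by apply: (fsubset_trans _ (fsubsetUr _ _)); exact: fsubsetUl.
have wA : (fs_supp (a *: u + v) `<=` A)%fset.
  by apply: (fsubset_trans _ (fsubsetUr _ _)); exact: fsubsetUr.
rewrite (fs_ext_wide uA) (fs_ext_wide vA) (fs_ext_wide wA).
rewrite scaler_sumr -big_split; apply: eq_bigr => t _.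
by rewrite fs_coefD fs_coefZ rmorphD rmorphM scalerDl scalerA.
Qed.

Lemma fs_ext0 : fs_ext 0 = 0.
Proof.
rewrite (@fs_ext_wide fset0) ?big_nil //.
by apply/fsubsetP => t; rewrite in_fs_supp fs_coef0 eqxx.
Qed.

Lemma fs_extD u v : fs_ext (u + v) = fs_ext u + fs_ext v.
Proof. by rewrite -{1}[u]scale1r fs_extP rmorph1 scale1r. Qed.

Lemma fs_extZ a u : fs_ext (a *: u) = f a *: fs_ext u.
Proof. by rewrite -{1}[a *: u]addr0 fs_extP fs_ext0 addr0. Qed.

Lemma fs_ext_delta t : fs_ext (fs_delta t) = g t.
Proof.
rewrite (@fs_ext_wide [fset t]%fset) ?big_seq_fset1 ?fs_deltaE ?eqxx.
  by rewrite rmorph1 scale1r.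
apply/fsubsetP => s; rewrite in_fs_supp fs_deltaE inE.
by case: (s =P t) => //; rewrite eqxx.
Qed.
End Extension.
End FreeModule.

(** An isomorphism of [M] with [R/I], recorded as a generator and its annihilator. Over a converse
    ring, [I] is a right ideal. *)
Definition cyclic_mod (R : pzRingType) (M : lmodType R) (m0 : M)
    (I : R -> Prop) :=
  (forall m, exists p, m = p *: m0) /\ (forall p, p *: m0 = 0 <-> I p).

Section CyclicIso.
Variables (R : pzRingType) (M N : lmodType R) (m0 : M) (n0 : N) (I : R -> Prop).
Hypotheses (Mcyc : cyclic_mod m0 I) (Ncyc : cyclic_mod n0 I).

Definition cyclic_coef (m : M) : R := projT1 (cid (Mcyc.1 m)).
Definition cyclic_map_fun (_ : cyclic_mod n0 I) (m : M) : N :=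
  cyclic_coef m *: n0.
Local Notation phi := (cyclic_map_fun Ncyc).

Lemma cyclic_coefE m : cyclic_coef m *: m0 = m.
Proof. by rewrite /cyclic_coef; case: cid. Qed.

(** The chosen coefficient of [p *: m0] differs from [p] by an element of [I], which kills [n0] as
    well. *)
Lemma cyclic_mapE p : phi (p *: m0) = p *: n0.
Proof.
apply/eqP; rewrite -subr_eq0 -scalerBl; apply/eqP/Ncyc.2/Mcyc.2.
by rewrite scalerBl cyclic_coefE subrr.
Qed.

Lemma cyclic_map_gen : phi m0 = n0.
Proof. by have := cyclic_mapE 1; rewrite !scale1r. Qed.

Fact cyclic_map_linear : linear phi.
Proof.
move=> a u v; rewrite -{1}[u]cyclic_coefE -{1}[v]cyclic_coefE scalerA -scalerDl.
by rewrite cyclic_mapE scalerDl -scalerA.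
Qed.
HB.instance Definition _ := GRing.isLinear.Build R M N _ phi cyclic_map_linear.
End CyclicIso.

Lemma cyclic_iso (R : pzRingType) (M N : lmodType R) (m0 : M) (n0 : N) I :
  cyclic_mod m0 I -> cyclic_mod n0 I ->
  exists f : {linear M -> N}, bijective f /\ f m0 = n0.
Proof.
move=> Mc Nc; exists (cyclic_map_fun Mc Nc); split; last first.
  exact: cyclic_map_gen.
exists (cyclic_map_fun Nc Mc) => [m|n].
  have [p ->] := Mc.1 m.
  rewrite -[LHS]/(cyclic_map_fun Nc Mc (cyclic_map_fun Mc Nc _)).
  by rewrite !cyclic_mapE.
have [p ->] := Nc.1 n.
rewrite -[LHS]/(cyclic_map_fun Mc Nc (cyclic_map_fun Nc Mc _)).
by rewrite !cyclic_mapE.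
Qed.

Section ExtCyclic.
Variables (D : pzRingType) (M : rmodType D) (m0 : M) (a : D).
Hypothesis Mcyc : cyclic_mod m0 (fun p => exists c : D, p = a * c).
Hypothesis a_reg : forall c, a * c = 0 -> c = 0.

(** The coefficient of [m0] itself is forced to be 1, so that [cover_lift] is exactly 1 on the basis
    vector over [m0]; an arbitrary choice would give this only modulo [a D]. *)
Definition ext_coef (m : M) : D^c :=
  if m == m0 then 1 else projT1 (cid (Mcyc.1 m)).

Lemma ext_coefE m : ext_coef m *: m0 = m.
Proof.
rewrite /ext_coef; case: eqP => [->|_]; first exact: scale1r.
by case: cid.
Qed.

(** Compares the canonical free cover of [M] with the free module on the single generator [m0]; it
    carries the syzygies into [a D]. *)
Definition cover_lift (u : free_cover M) : D^c :=
  fs_ext (idfun : {rmorphism D^c -> D^c}) (ext_coef : M -> (D^c)^o) u.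

Lemma cover_liftP (c : D^c) u v :
  cover_lift (c *: u + v) = c * cover_lift u + cover_lift v.
Proof.
exact (fs_extP (idfun : {rmorphism D^c -> D^c})
  (ext_coef : M -> (D^c)^o) c u v).
Qed.

Fact cover_lift_linear : linear (cover_lift : free_cover M -> (D^c)^o).
Proof. exact: cover_liftP. Qed.
HB.instance Definition _ := GRing.isLinear.Build D^c (free_cover M) (D^c)^o _
  (cover_lift : free_cover M -> (D^c)^o) cover_lift_linear.

Definition cover_gen (m : M) : free_cover M := @fs_delta D^c M m.

Lemma augmentationZ (c : D^c) (u : free_cover M) :
  augmentation (c *: u) = c *: augmentation u.
Proof. exact: (linearZZ (@augmentation D M)). Qed.

Lemma augmentation_gen m : augmentation (cover_gen m) = m.
Proof.
have E n : fs_val (cover_gen m) n = (n == m)%:R by [].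
have mE : ([set n | fs_val (cover_gen m) n != 0%R] `<=` [set m])%classic.
  move=> n; change (fs_val (cover_gen m) n != 0 -> n = m); rewrite E.
  by case: (n =P m) => // _; rewrite eqxx.
rewrite (augmentationE (finite_set1 m) mE) fset_set1 big_seq_fset1 E eqxx.
exact: scale1r.
Qed.

Lemma cover_lift_gen : cover_lift (cover_gen m0) = 1.
Proof.
rewrite [LHS](fs_ext_delta (idfun : {rmorphism D^c -> D^c})
  (ext_coef : M -> (D^c)^o)).
by rewrite /ext_coef eqxx.
Qed.

Lemma cover_liftE u : cover_lift u *: m0 = augmentation u.
Proof.
rewrite [in RHS](@fs_decomp D^c M u) linear_sum /=.
rewrite [cover_lift u](erefl : _ = \sum_(t <- fs_supp u) _) scaler_suml.
apply: eq_bigr => m _.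
transitivity ((fs_coef u m : D^c) *: augmentation (cover_gen m)); last first.
  exact/esym/augmentationZ.
rewrite augmentation_gen; move: (fs_coef u m : D^c) => c.
by rewrite -[in RHS](ext_coefE m) scalerA.
Qed.

Fact cover_rel_subproof : (a : D^c) *: cover_gen m0 \in
  GRing.SubmodClosed.clone D^c (free_cover M) (lin_ker (@augmentation D M)) _.
Proof.
apply/eqP; change (augmentation ((a : D^c) *: cover_gen m0) = 0).
rewrite augmentationZ augmentation_gen.
by apply/Mcyc.2; exists 1; rewrite mulr1.
Qed.
Definition cover_rel : syzygies M := SubMod cover_rel_subproof.

Lemma syzygy_coef (u : syzygies M) :
  exists c : D, cover_lift (syzygies_incl u) = a * c.
Proof.
apply/Mcyc.2; rewrite cover_liftE.
by have /eqP := sub_modP u.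
Qed.

Definition ext_gen_fun (u : syzygies M) : D := projT1 (cid (syzygy_coef u)).

Lemma ext_gen_funE u : a * ext_gen_fun u = cover_lift (syzygies_incl u).
Proof. by rewrite /ext_gen_fun; case: cid. Qed.

Lemma left_regular_inj b c : a * b = a * c -> b = c.
Proof.
move=> bc; apply/eqP; rewrite -subr_eq0; apply/eqP/a_reg.
by rewrite mulrBr bc subrr.
Qed.

Lemma ext_gen_funP (d : D) u v :
  ext_gen_fun ((d : D^c) *: u + v) = ext_gen_fun u * d + ext_gen_fun v.
Proof.
apply: left_regular_inj; rewrite mulrDr mulrA !ext_gen_funE.
exact: (cover_liftP d (syzygies_incl u) (syzygies_incl v)).
Qed.

Lemma ext_gen_fun_rel : ext_gen_fun cover_rel = 1.
Proof.
apply: left_regular_inj; rewrite ext_gen_funE mulr1.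
transitivity ((a : D^c) * cover_lift (cover_gen m0)).
  exact: (linearZZ (cover_lift : {linear free_cover M -> (D^c)^o})).
by rewrite cover_lift_gen mulr1.
Qed.

Definition ext_gen_hom : rhom (syzygies M) := SubMod (is_rhomP ext_gen_funP).
Definition ext_class (phi : rhom (syzygies M)) : Ext1 M := quot_pi _ phi.
Definition ext_gen : Ext1 M := ext_class ext_gen_hom.

Lemma ext_class_surj (xi : Ext1 M) : exists phi, ext_class phi = xi.
Proof. exact: (quot_pi_surj xi). Qed.

Lemma ext_classZ (p : D) phi : ext_class (p *: phi) = p *: ext_class phi.
Proof. exact: (quot_piZ _ p phi). Qed.

Lemma ext_class0 : ext_class 0 = 0.
Proof. by rewrite -(scale0r (0 : rhom (syzygies M))) ext_classZ scale0r. Qed.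

Lemma ext_class_eq (phi psi : rhom (syzygies M)) :
  ext_class phi = ext_class psi <->
  exists chi : rhom (free_cover M), forall u,
    rhom_fun chi (syzygies_incl u) = rhom_fun phi u - rhom_fun psi u.
Proof.
apply: iff_trans (quot_piE _ _ _) _; split=> [/asboolP[chi E]|[chi E]].
  by exists chi => u; rewrite -[RHS]/(rhom_fun (phi - psi) u) -E.
apply/asboolP; exists chi.
by apply: val_inj; apply/funext => u; exact: E.
Qed.

Lemma rhomZ (N : rmodType D) (chi : rhom N) (d : D) u :
  rhom_fun chi ((d : D^c) *: u) = rhom_fun chi u * d.
Proof.
have chi0 : rhom_fun chi 0 = 0.
  apply: (addIr (rhom_fun chi 0)); rewrite add0r.
  by have := rhomP chi 1 0 0; rewrite mulr1 (scaler0 N) addr0 => <-.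
by rewrite -[_ *: u]addr0 rhomP chi0 addr0.
Qed.

(* On syzygies, the generator is [u |-> a^-1 (cover_lift u)], and a homomorphism
   [phi] differs from [phi cover_rel] times the generator by the restriction of
   [u |-> phi (u - [m0] (cover_lift u))] from the free cover. *)
Lemma Ext1_cyclic : cyclic_mod ext_gen (fun p : D => exists c : D, p = c * a).
Proof.
split=> [xi|p].
  have [phi <-] := ext_class_surj xi; exists (rhom_fun phi cover_rel).
  rewrite -ext_classZ; apply/ext_class_eq.
  have rem_syz u : u - cover_lift u *: cover_gen m0 \in
      GRing.SubmodClosed.clone D^c (free_cover M)
        (lin_ker (@augmentation D M)) _.
    apply/eqP.
    change (augmentation (u - cover_lift u *: cover_gen m0) = 0).
    rewrite addrC -scaleNr augmentation_linear augmentation_gen scaleNr.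
    by rewrite cover_liftE addNr.
  pose rem u : syzygies M := SubMod (rem_syz u).
  have remP (d : D) u v : rem ((d : D^c) *: u + v) = (d : D^c) *: rem u + rem v.
    apply: val_inj => /=.
    change (((d : D^c) *: u + v) -
        cover_lift ((d : D^c) *: u + v) *: cover_gen m0 =
      (d : D^c) *: (u - cover_lift u *: cover_gen m0) +
      (v - cover_lift v *: cover_gen m0)).
    by rewrite cover_liftP scalerBr scalerDl scalerA opprD addrACA.
  have psiP (d : D) u v : rhom_fun phi (rem ((d : D^c) *: u + v)) =
      rhom_fun phi (rem u) * d + rhom_fun phi (rem v).
    by rewrite remP rhomP.
  exists (SubMod (is_rhomP psiP)) => u.
  change (rhom_fun phi (rem (syzygies_incl u)) =
    rhom_fun phi u - rhom_fun phi cover_rel * ext_gen_fun u).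
  have -> : rem (syzygies_incl u) =
      ((- ext_gen_fun u : D) : D^c) *: cover_rel + u.
    apply: val_inj => /=.
    change (syzygies_incl u - cover_lift (syzygies_incl u) *: cover_gen m0 =
      (- (ext_gen_fun u : D^c)) *: ((a : D^c) *: cover_gen m0) +
        syzygies_incl u).
    by rewrite -ext_gen_funE scaleNr scalerA addrC.
  by rewrite rhomP mulrN addrC.
rewrite -ext_classZ -ext_class0; split=> [/ext_class_eq[chi chiE]|[c ->]].
  (* Evaluate at [cover_rel]: the generator is 1 there, while [chi], defined on the whole free
     cover, takes the value [chi [m0] * a]. Conversely, [c * a] times the generator is the
     restriction of [c * cover_lift]. *)
  exists (rhom_fun chi (cover_gen m0)).
  rewrite -rhomZ -[_ *: _]/(syzygies_incl cover_rel) chiE.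
  change (p = p * ext_gen_fun cover_rel - 0).
  by rewrite ext_gen_fun_rel mulr1 subr0.
have chiP (d : D) u v : c * cover_lift ((d : D^c) *: u + v) =
    c * cover_lift u * d + c * cover_lift v :> D.
  by rewrite cover_liftP mulrDr mulrA.
apply/ext_class_eq; exists (SubMod (is_rhomP chiP)) => u.
change (c * (cover_lift (syzygies_incl u) : D) = c * a * ext_gen_fun u - 0).
by rewrite -ext_gen_funE mulrA subr0.
Qed.
End ExtCyclic.

Section AntiHom.
Variables (A : pzRingType) (tr : {rmorphism A -> A^c}).

Lemma antihomD x y : tr (x + y) = (tr x : A) + (tr y : A) :> A.
Proof. exact (rmorphD tr x y). Qed.
Lemma antihomN x : tr (- x) = - (tr x : A) :> A.
Proof. exact (rmorphN tr x). Qed.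
Lemma antihomM x y : tr (x * y) = (tr y : A) * (tr x : A) :> A.
Proof. exact (rmorphM tr x y). Qed.
End AntiHom.

(** By [Ext1_cyclic], the Ext group is the left module [D/Da]; the anti-involution [tr] turns the
    left ideal [Da] into the right ideal [tr(a) D]. *)
Lemma dual_cyclic (D : pzRingType) (tr : {rmorphism D -> D^c}) (M : rmodType D)
    (m0 : M) (a : D) : (forall p, tr (tr p) = p) ->
  cyclic_mod m0 (fun p => exists c : D, p = a * c) ->
  (forall c, a * c = 0 -> c = 0) ->
  exists e0 : dual tr M,
    cyclic_mod e0 (fun p => exists c : D, p = (tr a : D) * c).
Proof.
move=> trK Mcyc a_reg; exists (ext_gen Mcyc a_reg : dual tr M).
have [gen ann] := Ext1_cyclic Mcyc a_reg.
have scaleE (p : D^c) : p *: (ext_gen Mcyc a_reg : dual tr M) =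
    (tr p : D) *: ext_gen Mcyc a_reg :> Ext1 M by [].
split=> [m|p].
  by have [p ->] := gen m; exists (tr p : D); rewrite scaleE trK.
change (((tr p : D) *: ext_gen Mcyc a_reg = 0 :> Ext1 M) <->
  exists c : D, p = (tr a : D) * c).
rewrite ann; split=> [[c E]|[c ->]]; exists (tr c : D).
  by rewrite -antihomM -E trK.
by rewrite antihomM trK.
Qed.

(** * Regular elements of the Weyl algebras *)

Section InnerDerivation.
Variable A : pzRingType.
Implicit Types (s t c : A).

Definition inner t c := c * t - t * c.

Lemma innerM t a b : inner t (a * b) = inner t a * b + a * inner t b.
Proof. by rewrite /inner mulrBl mulrBr !mulrA [RHS]addrC addrA addrNK. Qed.

Lemma innerD t a b : inner t (a + b) = inner t a + inner t b.
Proof. by rewrite /inner mulrDl mulrDr opprD addrACA. Qed.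

Lemma innerN t a : inner t (- a) = - inner t a.
Proof. by rewrite /inner mulNr mulrN opprB opprK addrC. Qed.

Lemma inner0 t : inner t 0 = 0. Proof. by rewrite /inner mulr0 mul0r subrr. Qed.

Lemma inner_id t : inner t t = 0. Proof. exact: subrr. Qed.

Lemma innerMn t c n : inner t (c *+ n) = inner t c *+ n.
Proof.
by elim: n => [|n IHn]; rewrite ?mulr0n ?inner0 // !mulrS innerD IHn.
Qed.

Definition inner_nilp t c := exists n, iter n (inner t) c = 0.

Lemma iter_inner0 t m : iter m (inner t) 0 = 0.
Proof. by elim: m => //= m ->; exact: inner0. Qed.

Lemma iter_innerD t m a b :
  iter m (inner t) (a + b) = iter m (inner t) a + iter m (inner t) b.
Proof. by elim: m => //= m ->; exact: innerD. Qed.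

Lemma iter_inner_le t c n m :
  (n <= m)%N -> iter n (inner t) c = 0 -> iter m (inner t) c = 0.
Proof. by move=> /subnK <- c0; rewrite iterD c0 iter_inner0. Qed.

Lemma inner_nilpD t a b :
  inner_nilp t a -> inner_nilp t b -> inner_nilp t (a + b).
Proof.
move=> [n an] [m bm]; exists (n + m)%N.
by rewrite iter_innerD (iter_inner_le (leq_addr _ _) an)
  (iter_inner_le (leq_addl _ _) bm) addr0.
Qed.

Lemma inner_nilpN t a : inner_nilp t a -> inner_nilp t (- a).
Proof.
move=> [n an]; exists n.
suff -> : iter n (inner t) (- a) = - iter n (inner t) a.
  by rewrite an oppr0.
by elim: {an} n => //= n ->; exact: innerN.
Qed.

(** By the Leibniz rule each application of the derivation lowers the nilpotency exponent of one of
    the two factors, so [n + m] applications kill every term. *)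
Lemma inner_nilpM t a b :
  inner_nilp t a -> inner_nilp t b -> inner_nilp t (a * b).
Proof.
move=> [n an] [m bm]; exists (n + m)%N.
elim: {n m}(n + m)%N {-2}n {-2}m (leqnn (n + m)) a b an bm => [|N IHN] n m.
  rewrite leqn0 addn_eq0 => /andP[/eqP-> _] a b /= -> _.
  by rewrite mul0r iter_inner0.
case: n => [|n] nm a b an bm.
  by rewrite /= in an; rewrite an mul0r iter_inner0.
case: m => [|m] in nm bm *.
  by rewrite /= in bm; rewrite bm mulr0 iter_inner0.
rewrite addSn iterSr innerM iter_innerD (IHN n m.+1) -?iterSr // add0r.
rewrite addnS -addSn (IHN n.+1 m) -?iterSr //.
by move: nm; rewrite addnS ltnS.
Qed.

(* If [s c = 0] then [s (delta^(n+1) c) = - (n+1) (delta^n c)], where [delta] is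
   the derivation [inner t]; so [c = 0] by descent from [delta^n c = 0]. *)
Lemma inner_regular s t : s * t - t * s = 1 ->
  (forall n c, c *+ n.+1 = 0 -> c = 0) -> (forall c, inner_nilp t c) ->
  forall c, s * c = 0 -> c = 0.
Proof.
move=> st tors nilp c sc.
have E n : s * iter n.+1 (inner t) c = - (iter n (inner t) c *+ n.+1).
  have ds : inner t s = 1 by [].
  elim: n => [|n IHn].
    have := congr1 (inner t) sc; rewrite innerM ds inner0 mul1r /= => /eqP.
    by rewrite addr_eq0 eq_sym eqr_oppLR => /eqP.
  have := congr1 (inner t) IHn; rewrite innerM ds mul1r innerN innerMn -!iterS.
  move/(canRL (addKr _)) => ->.
  by rewrite -opprD -mulrS.
have [n] := nilp c.
elim: n => // n IHn nc; apply/IHn/(tors n)/eqP.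
by rewrite -oppr_eq0 -E nc mulr0.
Qed.
End InnerDerivation.

Section Palg.
Variables (k : numFieldType) (I : Type) (rel : expr k I -> expr k I -> Prop).

Lemma palg_torsion_free n (c : palg rel) : c *+ n.+1 = 0 -> c = 0.
Proof.
move=> c0; rewrite -[c]mul1r -(rmorph1 (pcst rel)).
rewrite -(@mulVf _ (n.+1)%:R) ?pnatr_eq0 // rmorphM rmorph_nat.
by rewrite -mulrA mulr_natl c0 mulr0.
Qed.

(** The elements killed by a power of the derivation form a subalgebra that contains the scalars. *)
Lemma palg_inner_nilp (t : palg rel) :
  (forall i, inner_nilp t (gen rel i)) -> forall c, inner_nilp t c.
Proof.
move=> gn; apply: palg_ind => [i|a|a b|a|a b]; first exact: gn.
- by exists 1%N; rewrite /= /inner pcstC subrr.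
- exact: inner_nilpD.
- exact: inner_nilpN.
- exact: inner_nilpM.
Qed.
End Palg.

Section Regular.
Variable k : numFieldType.

Lemma weyl_d_regular (c : weyl k) : W_d k * c = 0 -> c = 0.
Proof.
apply: (@inner_regular _ _ (W_t k)); first by rewrite weylE addrAC subrr add0r.
  exact: palg_torsion_free.
apply: palg_inner_nilp => -[]; first by exists 1%N; exact: inner_id.
exists 2%N; rewrite /= [inner _ (gen _ _)](_ : _ = 1).
  by rewrite /inner mulr1 mul1r subrr.
by rewrite /inner -/(W_d k) weylE addrAC subrr add0r.
Qed.

Lemma weyl_t_regular (c : weyl k) : W_t k * c = 0 -> c = 0.
Proof.
(* Here [inner (- d)] is [c |-> d c - c d], differentiation with respect to [t], and
   [t (-d) - (-d) t = 1]. *)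
apply: (@inner_regular _ _ (- W_d k)).
- by rewrite mulrN mulNr opprK weylE addrA addNr add0r.
- exact: palg_torsion_free.
apply: palg_inner_nilp => -[]; last first.
  by exists 1%N; rewrite /= /inner mulrN mulNr subrr.
exists 2%N; rewrite /= [inner _ (gen _ _)](_ : _ = 1).
  by rewrite /inner mulr1 mul1r subrr.
by rewrite /inner -/(W_t k) mulrN mulNr opprK weylE addrA addNr add0r.
Qed.

Lemma tweyl_d_regular (c : tweyl k) : L_d k * c = 0 -> c = 0.
Proof.
apply: (@inner_regular _ _ (L_x k)).
  by rewrite tweyl_dxE addrAC subrr add0r.
  exact: palg_torsion_free.
apply: palg_inner_nilp => -[]; first by exists 1%N; exact: inner_id.
  by exists 1%N; rewrite /= /inner -/(L_y k) tweyl_yxE tweyl_xyE subrr.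
exists 2%N; rewrite /= [inner _ (gen _ _)](_ : _ = 1).
  by rewrite /inner mulr1 mul1r subrr.
by rewrite /inner -/(L_d k) tweyl_dxE addrAC subrr add0r.
Qed.
End Regular.

(** * Modules with a graded basis *)

Section Graded.
Variables (k : fieldType) (I : Type) (rel : expr k I -> expr k I -> Prop).
Local Notation A := (palg rel).
Local Notation cst := (pcst rel).

(** Linearity over [k] and the values on the [e n] make [coord] surjective too, so together with
    injectivity they say that [e] is a [k]-basis of [M]. *)
Definition graded_coord (M : rmodType A) (e : int -> M)
    (coord : M -> fs_mod int k^o) :=
  [/\ injective coord,
    forall a u v, coord ((cst a : A^c) *: u + v) = a *: coord u + coord v
    & forall n, coord (e n) = fs_delta k n].

Definition graded_basis (M : rmodType A) (e : int -> M) :=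
  exists coord, graded_coord e coord.

Section Coord.
Variables (M : rmodType A) (e : int -> M) (coord : M -> fs_mod int k^o).
Hypothesis Mcoord : graded_coord e coord.

Lemma coordD u v : coord (u + v) = coord u + coord v.
Proof. by case: Mcoord => _ /(_ 1 u v) + _; rewrite rmorph1 !scale1r. Qed.

Lemma coord_zero : coord 0 = 0.
Proof. by apply: (addIr (coord 0)); rewrite -coordD !add0r. Qed.

Lemma coordZ c u : coord ((cst c : A^c) *: u) = c *: coord u.
Proof.
by case: Mcoord => _ /(_ c u 0) + _; rewrite !addr0 coord_zero addr0.
Qed.

Lemma coord_delta n : coord (e n) = fs_delta k n.
Proof. by case: Mcoord. Qed.

Lemma coord_decomp u : u = \sum_(n <- fs_supp (coord u))
  (cst (fs_coef (coord u) n) : A^c) *: e n.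
Proof.
have [coord_inj _ _] := Mcoord; apply: coord_inj.
rewrite [LHS](fs_decomp (coord u)) (big_morph coord coordD coord_zero).
by apply: eq_bigr => n _; rewrite coordZ coord_delta.
Qed.
End Coord.

Definition right_ideal (J : A -> Prop) :=
  [/\ J 0, forall p q, J p -> J q -> J (p + q) & forall p q, J p -> J (p * q)].

(** One family indexed by the integers: powers of the raising operator [a] lead upwards from [e m],
    powers of the lowering operator [b] downwards. *)
Definition bipow (a b : A) (j : int) : A :=
  match j with Posz n => a ^+ n | Negz n => b ^+ n.+1 end.

Variables (M : rmodType A) (e : int -> M) (m : int) (a b : A) (J : A -> Prop).
Hypothesis J_ideal : right_ideal J.
Hypothesis J_ann : forall p, J p -> (p : A^c) *: e m = 0.
Hypothesis a_step : forall n : int, m <= n ->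
  exists2 c : k, c != 0 & (a : A^c) *: e n = (cst c : A^c) *: e (n + 1).
Hypothesis b_step : forall n : int, n <= m ->
  exists2 c : k, c != 0 & (b : A^c) *: e n = (cst c : A^c) *: e (n - 1).
Hypothesis bipow_step : forall i j,
  exists c j', J (bipow a b j * gen rel i - cst c * bipow a b j').

Lemma rscaleA (p q : A) (u : M) :
  (q : A^c) *: ((p : A^c) *: u) = ((p * q : A) : A^c) *: u.
Proof. exact: scalerA. Qed.

Lemma rscaleN (p : A) (u : M) :
  ((- p : A) : A^c) *: u = - ((p : A^c) *: u).
Proof. exact: scaleNr. Qed.

Lemma rscaleD (p q : A) (u : M) :
  ((p + q : A) : A^c) *: u = (p : A^c) *: u + (q : A^c) *: u.
Proof. exact: scalerDl. Qed.

Lemma rscaleC (p : A) c (u : M) :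
  (p : A^c) *: ((cst c : A^c) *: u) = (cst c : A^c) *: ((p : A^c) *: u).
Proof. by rewrite !rscaleA pcstC. Qed.

Lemma bipow_act j : exists c : k, c != 0 /\
  (bipow a b j : A^c) *: e m = (cst c : A^c) *: e (m + j).
Proof.
case: j => n /=.
  elim: n => [|n [c [c0 IHn]]].
    by exists 1; rewrite oner_eq0 addr0 expr0 rmorph1 scale1r.
  have [|c' c'0 E] := a_step (n := m + n); first by rewrite lerDl.
  exists (c * c'); rewrite mulf_neq0 // exprSr -rscaleA IHn rscaleC E rscaleA.
  by rewrite -rmorphM mulrC -addrA -[n.+1]addn1 PoszD.
elim: n => [|n [c [c0 IHn]]].
  by have [c c0 E] := b_step (lexx m); exists c; rewrite expr1.
have [|c' c'0 E] := b_step (n := m + Negz n); first by rewrite gerDl.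
exists (c * c'); rewrite mulf_neq0 // exprSr -rscaleA IHn rscaleC E rscaleA.
by rewrite -rmorphM mulrC -addrA !NegzE -[n.+2]addn1 PoszD opprD.
Qed.

(* [J] and the [bipow a b j] together span a right ideal that contains 1, and the
   images of [e m] under the [bipow a b j] are linearly independent. *)
Lemma graded_cyclic : graded_basis e -> cyclic_mod (e m) J.
Proof.
move=> [coord Mc]; have [J0 JD JM] := J_ideal.
have Jcst c p : J p -> J (cst c * p) by rewrite pcstC; exact: JM.
have [c cP] := boolp.choice bipow_act.
(* [g n] is normalized to carry [e m] to [e n], so [sigma] is a [k]-linear section of the map from
   [p] to its action on [e m]. *)
pose g n : (A^c)^o := cst (c (n - m))^-1 * bipow a b (n - m).
pose sigma u : A := fs_ext (pcst_c rel) g (coord u).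
have sigmaE u : sigma u = \sum_(n <- fs_supp (coord u))
    cst (fs_coef (coord u) n) * g n.
  by apply: eq_bigr => n _; rewrite pcstC.
have sigmaD u v : sigma (u + v) = sigma u + sigma v.
  rewrite /sigma (coordD Mc).
  exact (fs_extD (pcst_c rel) g (coord u) (coord v)).
have sigmaZ d u : sigma ((cst d : A^c) *: u) = cst d * sigma u.
  rewrite /sigma (coordZ Mc) pcstC.
  exact (fs_extZ (pcst_c rel) g d (coord u)).
have sigma0 : sigma 0 = 0.
  by rewrite /sigma (coord_zero Mc); exact (fs_ext0 (pcst_c rel) g).
have sigma_e n : sigma (e n) = g n.
  by rewrite /sigma (coord_delta Mc); exact (fs_ext_delta (pcst_c rel) g n).
(* [S p] says that the action of [p] on [e m] determines [p] modulo [J]. Once it holds for all [p],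
   whatever kills [e m] lies in [J]. *)
pose S (p : A) := J (p - sigma ((p : A^c) *: e m)).
have SD p q : S p -> S q -> S (p + q).
  move=> Sp Sq; have := JD _ _ Sp Sq; rewrite addrACA -opprD -sigmaD.
  by rewrite -scalerDl.
have Scst d p : S p -> S (cst d * p).
  move=> /(Jcst d); rewrite mulrBr -sigmaZ rscaleA.
  by rewrite -(pcstC d p).
have SJ p : J p -> S p by move=> Jp; rewrite /S (J_ann Jp) sigma0 subr0.
have SN p : S p -> S (- p).
  by move=> /(Scst (-1)); rewrite rmorphN rmorph1 mulN1r.
have Sbipow j : S (bipow a b j).
  rewrite /S (cP j).2 sigmaZ sigma_e /g (addrC m) addrK mulrA -rmorphM.
  by rewrite mulfV ?(cP j).1 // rmorph1 mul1r subrr.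
have Sgen p i : S p -> S (p * gen rel i).
  move=> Sp; rewrite -[p](subrK (sigma ((p : A^c) *: e m))) mulrDl; apply: (SD).
    exact/SJ/JM.
  rewrite sigmaE mulr_suml.
  apply: (big_ind S) => [||n _]; [exact: SJ|exact: SD|].
  rewrite -mulrA; apply: (Scst); rewrite /g -mulrA; apply: (Scst).
  have [d [j' dj]] := bipow_step i (n - m).
  rewrite -[X in S X](subrK (cst d * bipow a b j')).
  by apply: (SD); [exact: SJ | exact: Scst].
have Smul : forall q p, S p -> S (p * q).
  apply: palg_ind => [i|d|q q' Sq Sq'|q Sq|q q' Sq Sq'] p Sp.
  - exact: Sgen.
  - by rewrite -pcstC; exact: Scst.
  - by rewrite mulrDr; apply: (SD); [exact: Sq | exact: Sq'].
  - by rewrite mulrN; apply/SN/Sq.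
  - by rewrite mulrA; apply/Sq'/Sq.
have S_all p : S p by rewrite -[p]mul1r; apply: Smul; exact: (Sbipow 0).
split=> [u|p]; last first.
  by split=> [p0|/J_ann//]; have := S_all p; rewrite /S p0 sigma0 subr0.
exists (sigma u); rewrite [LHS](coord_decomp Mc u) sigmaE scaler_suml.
apply: eq_bigr => n _.
rewrite pcstC -rscaleA; congr (_ *: _).
rewrite /g pcstC -rscaleA (cP (n - m)).2 rscaleA -rmorphM (addrC m) subrK.
by rewrite mulfV ?(cP (n - m)).1 // rmorph1 scale1r.
Qed.
End Graded.

Section FormsModule.
Variables (k : fieldType) (I : Type) (rel : expr k I -> expr k I -> Prop).
Local Notation forms := (fs_mod int k^o).
Variable g : I -> {linear forms -> forms}.
Hypothesis h : forall s t, rel s t -> act g s =1 act g t.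

Lemma wshift_delta (c : int -> k) s n :
  wshift c s (fs_delta k n) = c (n - s) *: fs_delta k (n - s).
Proof.
apply: fs_coef_inj => m; rewrite fs_coefZ [LHS]wshiftE.
change (c m * (m + s == n)%:R = c (n - s) * (m == n - s)%:R).
rewrite eq_sym -subr_eq eq_sym.
by case: eqP => [->|_]; rewrite ?mulr0.
Qed.

Definition forms_e (n : int) : pmod h := fs_delta k n.

Lemma pmod_graded_basis : graded_basis forms_e.
Proof.
exists (fun u => u); split=> // a u v.
exact (congr1 (fun w : forms => w + v) (pmodE (h := h) (ECst _ a) u)).
Qed.

Lemma pmod_wshift i c s : g i =1 wshift c s -> forall n,
  (gen rel i : (palg rel)^c) *: forms_e n =
  (pcst rel (c (n - s)) : (palg rel)^c) *: forms_e (n - s).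
Proof.
move=> gi n; apply: etrans (pmodE (h := h) (EGen _ i) (forms_e n)) _.
apply: etrans (gi _) _; apply: etrans (wshift_delta c s n) _.
exact: esym (pmodE (h := h) (ECst _ (c (n - s))) (forms_e (n - s))).
Qed.
End FormsModule.

(** * Graded bases of Omega and of its direct images *)

Section Models.
Variable k : numFieldType.
Local Notation forms := (fs_mod int k^o).
Local Notation tcst := (pcst (@tweyl_rel k)).
Local Notation wcst := (pcst (@weyl_rel k)).
Local Notation twc := ((tweyl k)^c).
Local Notation wc := ((weyl k)^c).

Definition tweyl_basis (M : rmodType (tweyl k)) (e : int -> M) :=
  [/\ graded_basis (rel := @tweyl_rel k) e,
    forall n, (L_x k : twc) *: e n = e (n + 1),
    forall n, (L_y k : twc) *: e n = e (n - 1)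
    & forall n, (L_d k : twc) *: e n = (tcst (- n%:~R) : twc) *: e (n - 1)].

Definition weyl_basis (M : rmodType (weyl k)) (alpha beta : int -> k)
    (e : int -> M) := [/\ graded_basis (rel := @weyl_rel k) e,
  forall n, (W_t k : wc) *: e n = (wcst (alpha n) : wc) *: e (n + 1)
  & forall n, (W_d k : wc) *: e n = (wcst (beta n) : wc) *: e (n - 1)].

Definition Omega_e (n : int) : Omega k := forms_e (Omega_rel (k := k)) n.

Lemma Omega_basis : tweyl_basis Omega_e.
Proof.
split=> [|n|n|n]; first exact: pmod_graded_basis.
- have := @pmod_wshift _ _ _ _ (Omega_rel (k := k))
    Lx (fun=> 1) (-1) (fun=> erefl) n.
  by rewrite rmorph1 scale1r opprK.
- have := @pmod_wshift _ _ _ _ (Omega_rel (k := k))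
    Ly (fun=> 1) 1 (fun=> erefl) n.
  by rewrite rmorph1 scale1r.
- have := @pmod_wshift _ _ _ _ (Omega_rel (k := k)) Ld _ 1 (fun=> erefl) n.
  by rewrite subrK.
Qed.

(* In the coordinate [z = 1/x], [z^n dz = - x^(-n-2) dx]. *)
Fact reflect_key : unit. Proof. by []. Qed.
Definition reflect_idx : int -> int :=
  locked_with reflect_key (fun n => - n - 2).

Lemma reflectE n : reflect_idx n = - n - 2.
Proof. by rewrite /reflect_idx unlock. Qed.
Lemma reflectK : involutive reflect_idx.
Proof. by move=> n; rewrite !reflectE; ring. Qed.
Lemma reflect_succ n : reflect_idx (n + 1) = reflect_idx n - 1.
Proof. by rewrite !reflectE; ring. Qed.
Lemma reflect_pred n : reflect_idx (n - 1) = reflect_idx n + 1.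
Proof. by rewrite !reflectE; ring. Qed.

Fact reflect_subproof (u : forms) :
  ((fun n => fs_coef u (reflect_idx n)) : int -> k^o) \in
  GRing.SubmodClosed.clone k (int -> k^o) (@Defs.finsupp k int k^o) _.
Proof.
apply: Defs.finsuppP.
apply: (@sub_finite_set _ _
  (reflect_idx @` [set m | fs_coef u m != 0%R])%classic); last first.
  exact/finite_image/fs_finite.
by move=> n un; exists (reflect_idx n) => //; exact: reflectK.
Qed.
Definition reflect_forms (u : forms) : forms := SubMod (reflect_subproof u).

Lemma reflect_formsE u n :
  fs_coef (reflect_forms u) n = fs_coef u (reflect_idx n).
Proof. by []. Qed.

Lemma reflect_formsP a u v :
  reflect_forms (a *: u + v) = a *: reflect_forms u + reflect_forms v.
Proof. exact: fs_coef_inj. Qed.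

Lemma reflect_forms_inj : injective reflect_forms.
Proof.
move=> u v uv; apply: fs_coef_inj => n.
by rewrite -[n]reflectK -!reflect_formsE uv.
Qed.

Lemma reflect_forms_delta n :
  reflect_forms (fs_delta k (reflect_idx n)) = fs_delta k n.
Proof.
apply: fs_coef_inj => m; rewrite reflect_formsE !fs_deltaE.
by rewrite (can_eq reflectK).
Qed.

Lemma graded_basis_reflect (I : Type) (rel : expr k I -> expr k I -> Prop)
    (M : rmodType (palg rel)) (e : int -> M) :
  graded_basis e -> graded_basis (e \o reflect_idx).
Proof.
move=> [coord [coord_inj coordP coord_e]].
exists (reflect_forms \o coord); split=> [|a u v|n] /=.
- exact: inj_comp reflect_forms_inj coord_inj.
- by rewrite coordP reflect_formsP.
- by rewrite coord_e reflect_forms_delta.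
Qed.

Lemma graded_basis_res (I J : Type) (relI : expr k I -> expr k I -> Prop)
    (relJ : expr k J -> expr k J -> Prop)
    (r : {rmorphism palg relI -> palg relJ})
    (M : rmodType (palg relJ)) (e : int -> M) :
  (forall a, r (pcst relI a) = pcst relJ a) -> graded_basis e ->
  graded_basis (rel := relI) (M := res (conv_hom r) M) e.
Proof.
move=> ra [coord [coord_inj coordP coord_e]].
exists (coord : res (conv_hom r) M -> forms); split=> // a u v.
by apply: etrans (coordP a u v); rewrite -(ra a).
Qed.

Lemma chart_z_cst a : chart_z k (wcst a) = tcst a.
Proof. exact: palg_lift_cst. Qed.

Lemma jdotE (r : {rmorphism weyl k -> tweyl k}) (M : rmodType (tweyl k))
    (p : weyl k) a (u v : M) : r (wcst a) = tcst a ->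
  (r p : twc) *: u = (tcst a : twc) *: v ->
  (p : wc) *: (u : jdot r M) = (wcst a : wc) *: (v : jdot r M).
Proof. by move=> ra; rewrite -ra. Qed.

Section Jdot.
Variables (M : rmodType (tweyl k)) (e : int -> M).
Hypothesis Me : tweyl_basis e.

Lemma jdot_basis_x : weyl_basis (M := jdot (chart_x k) M) (fun=> 1)
  (fun n => - n%:~R) e.
Proof.
have [eb ex ey ed] := Me.
split=> [|n|n]; first exact: graded_basis_res (@chart_x_cst k) eb.
- by apply: jdotE (chart_x_cst _) _; rewrite chart_x_t rmorph1 scale1r ex.
- by apply: jdotE (chart_x_cst _) _; rewrite chart_x_d ed.
Qed.

(** The common sign in [z^n dz = - x^(-n-2) dx] is dropped, as it does not change the structure
    constants. For [d/dz = - x^2 d/dx], the two factors [x] move the index [-n-2] to [-n], which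
    yields the same coefficient [-n] as in the chart [x]. *)
Lemma jdot_basis_z : weyl_basis (M := jdot (chart_z k) M) (fun=> 1)
  (fun n => - n%:~R) (e \o reflect_idx).
Proof.
have [eb ex ey ed] := Me.
split=> [|n|n].
- exact: graded_basis_res chart_z_cst (graded_basis_reflect eb).
- apply: jdotE (chart_z_cst _) _.
  by rewrite chart_z_t rmorph1 scale1r ey /= reflect_succ.
- apply: jdotE (chart_z_cst _) _.
  rewrite chart_z_d (rscaleN (M := M)) -!(rscaleA (M := M)) /= !ex ed.
  have -> : (reflect_idx n + 1 + 1)%:~R = - n%:~R :> k.
    by rewrite -rmorphN reflectE; congr (_%:~R); ring.
  by rewrite -(rscaleN (M := M)) -rmorphN !opprK reflect_pred addrK.
Qed.
End Jdot.

(** All that the computation of [j_!] uses about a chart, so that one argument covers both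
    charts. *)
Definition standard_chart (r : {rmorphism weyl k -> tweyl k}) :=
  forall (M : rmodType (tweyl k)) (e : int -> M), tweyl_basis e ->
  exists e' : int -> jdot r M, weyl_basis (fun=> 1) (fun n => - n%:~R) e'.

Lemma chart_x_standard : standard_chart (chart_x k).
Proof. by move=> M e Me; exists e; exact: jdot_basis_x. Qed.

Lemma chart_z_standard : standard_chart (chart_z k).
Proof. by move=> M e Me; exists (e \o reflect_idx); exact: jdot_basis_z. Qed.
End Models.

(** * Cyclic presentations over the Weyl algebras *)

Section Cyclic.
Variable k : numFieldType.
Local Notation tcst := (pcst (@tweyl_rel k)).
Local Notation wcst := (pcst (@weyl_rel k)).
Local Notation twc := ((tweyl k)^c).
Local Notation wc := ((weyl k)^c).
Local Notation t := (W_t k).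
Local Notation d := (W_d k).

Lemma principal_right_ideal (I : Type) (rel : expr k I -> expr k I -> Prop)
  (a : palg rel) : right_ideal (fun p => exists q, p = a * q).
Proof.
split=> [|p q [x ->] [y ->]|p q [x ->]].
- by exists 0; rewrite mulr0.
- by exists (x + y); rewrite mulrDr.
- by exists (x * q); rewrite mulrA.
Qed.

Lemma weyl_dt_pow n : d ^+ n.+1 * t = t * d ^+ n.+1 + d ^+ n *+ n.+1.
Proof.
elim: n => [|n IHn]; first by rewrite !expr1 expr0 weylE.
rewrite exprS -mulrA IHn mulrDr mulrA weylE mulrDl mul1r -mulrA -exprS.
by rewrite mulrnAr -exprS -addrA -mulrS.
Qed.

Lemma weyl_td_pow n : t ^+ n * (t * d) = t * d * t ^+ n - t ^+ n *+ n.
Proof.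
elim: n => [|n IHn]; first by rewrite !expr0 mul1r mulr1 mulr0n subr0.
rewrite exprSr -mulrA.
have -> : t * (t * d) = t * d * t - t.
  by rewrite -[t * d * t]mulrA weylE mulrDr mulr1 addrK.
rewrite mulrBr mulrA IHn mulrBl -!mulrA mulrnAl -!exprSr -addrA -opprD.
by rewrite -mulrSr.
Qed.

(** Modulo [(td + c) D], the products [t^(n+1) d] and [d^(n+1) t] reduce to multiples of [t^n] and
    [d^n], as [graded_cyclic] requires. It is applied to [j_.] with [c = 0], [m = -1] and to the
    model of [j_!] with [c = 1], [m = 0], where [td + 1 = dt]. *)
Lemma weyl_cyclic (M : rmodType (weyl k)) (alpha beta : int -> k) (e : int -> M)
    (m : int) (c : k) : weyl_basis alpha beta e ->
  (forall n, m <= n -> alpha n != 0) -> (forall n, n <= m -> beta n != 0) ->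
  ((t * d + wcst c : weyl k) : wc) *: e m = 0 ->
  cyclic_mod (e m) (fun p => exists q, p = (t * d + wcst c) * q).
Proof.
move=> [eb et ed] alpha0 beta0 c0.
pose J (p : weyl k) := exists q, p = (t * d + wcst c) * q.
have J0 p : p = 0 -> J p by move->; exists 0; rewrite mulr0.
apply: (graded_cyclic (a := t) (b := d) (J := J)) => //.
- exact: principal_right_ideal.
- by move=> p [q ->]; rewrite -(rscaleA (M := M)) c0 scaler0.
- by move=> n mn; exists (alpha n); [exact: alpha0 | exact: et].
- by move=> n nm; exists (beta n); [exact: beta0 | exact: ed].
case=> -[[|n]|n] /=.
- by exists 1, 1; apply: J0; rewrite rmorph1 expr0 !mul1r subrr.
- exists 1, n.+2%:Z; apply: J0.
  by rewrite rmorph1 mul1r /= -[gen _ _]/t -exprSr subrr.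
(* [d^(n+1) t = (td + n + 1) d^n], and the leftmost [td] may be replaced by [-c] modulo the
   ideal. *)
- exists (n.+1%:R - c), (- n%:Z); exists (d ^+ n).
  have -> : bipow t d (- n%:Z) = d ^+ n by case: (n).
  rewrite [gen _ _]/(W_t k) weyl_dt_pow exprS mulrA -addrA mulrDl.
  congr (_ + _).
  by rewrite rmorphB rmorph_nat mulrBl mulr_natl opprB addrCA subrr addr0.
- by exists 1, (-1); apply: J0; rewrite rmorph1 expr0 !mul1r subrr.
- exists (- (n%:R + c)), n; exists (t ^+ n).
  rewrite /= exprSr -mulrA weyl_td_pow mulrDl -addrA; congr (_ + _).
  rewrite rmorphN rmorphD rmorph_nat mulNr opprK mulrDl mulr_natl.
  by rewrite addrA addNr add0r.
- exists 1, (Negz n.+1); apply: J0.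
  by rewrite rmorph1 mul1r /= -[gen _ _]/d -exprSr subrr.
Qed.

(** For [Omega], [e 0] is the form [dx], which [d] kills; the invertible [x] carries it to all the
    other basis vectors. *)
Lemma tweyl_cyclic (M : rmodType (tweyl k)) (e : int -> M) : tweyl_basis e ->
  cyclic_mod (e 0) (fun p => exists q, p = L_d k * q).
Proof.
move=> [eb ex ey ed].
pose J (p : tweyl k) := exists q, p = L_d k * q.
have J0 p : p = 0 -> J p by move->; exists 0; rewrite mulr0.
have xpow_x n : L_xpow k n * L_x k = L_xpow k (n + 1).
  case: n => n.
    have -> : Posz n + 1 = n.+1 by lia.
    by rewrite /= exprSr.
  have -> : Negz n + 1 = - n%:Z by rewrite NegzE; lia.
  have -> : L_xpow k (- n%:Z) = L_y k ^+ n by case: (n).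
  by rewrite /= exprSr -mulrA tweyl_yxE mulr1.
have xpow_y n : L_xpow k n * L_y k = L_xpow k (n - 1).
  by rewrite -{1}[n](subrK 1) -xpow_x -mulrA tweyl_xyE mulr1.
have cst1 : tcst 1 = 1 by rewrite rmorph1.
apply: (graded_cyclic (a := L_x k) (b := L_y k) (J := J)) => //.
- exact: principal_right_ideal.
- move=> p [q ->]; rewrite -(rscaleA (M := M)) ed oppr0 rmorph0 (scale0r (e _)).
  exact: scaler0.
- by move=> n _; exists 1; rewrite ?oner_eq0 // ex cst1 scale1r.
- by move=> n _; exists 1; rewrite ?oner_eq0 // ey cst1 scale1r.
move=> i j; rewrite -[bipow _ _ j]/(L_xpow k j); case: i.
- exists 1, (j + 1); apply: J0.
  by rewrite cst1 mul1r [gen _ _]/(L_x k) xpow_x subrr.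
- exists 1, (j - 1); apply: J0.
  by rewrite cst1 mul1r [gen _ _]/(L_y k) xpow_y subrr.
exists (- j%:~R), (j - 1); exists (L_xpow k j).
rewrite -[bipow _ _ _]/(L_xpow k (j - 1)) -[gen _ _]/(L_d k) L_xpow_d mulrDr.
by rewrite rmorphN rmorph_int mulNr opprK -xpow_y !mulrzl mulrzAr.
Qed.
End Cyclic.

(** * The module j_! Omega on a chart *)

Section ShriekModel.
Variable k : numFieldType.
Local Notation forms := (fs_mod int k^o).

(* The structure constants of D/(dt)D in the basis consisting of [e_n = t^n] for
   [n >= 0] and [e_n = d^(-n)] for [n < 0]: [e_n t = shriek_alpha n e_(n+1)] and
   [e_n d = shriek_beta n e_(n-1)]. *)
Definition shriek_alpha (n : int) : k := if 0 <= n then 1 else - (n + 1)%:~R.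
Definition shriek_beta (n : int) : k := if 1 <= n then - n%:~R else 1.

Definition shriek_act (i : weyl_gen) : {linear forms -> forms} :=
  match i with
  | Wt => wshift (fun n => shriek_alpha (n - 1)) (-1)
  | Wd => wshift (fun n => shriek_beta (n + 1)) 1
  end.

(** The relation [dt = td + 1] applied to [e n]. At [n = 0] the left side is 0 because
    [shriek_alpha (-1) = 0]. *)
Lemma shriek_coef_rel n : shriek_alpha (n - 1) * shriek_beta n =
  shriek_beta (n + 1) * shriek_alpha n + 1.
Proof.
rewrite /shriek_alpha /shriek_beta.
have [->|[n0|n0]] : n = 0 \/ (n < 0 \/ 0 < n) by lia.
- by rewrite sub0r add0r /= !mulr1 addNr !rmorph0 oppr0 rmorph1 addNr.
- have -> : (0 <= n - 1) = false by lia.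
  have -> : (1 <= n) = false by lia.
  have -> : (1 <= n + 1) = false by lia.
  have -> : (0 <= n) = false by lia.
  by rewrite mulr1 mul1r subrK rmorphD opprD addrNK.
- have -> : (0 <= n - 1) by lia.
  have -> : 1 <= n by lia.
  have -> : (1 <= n + 1) by lia.
  have -> : (0 <= n) by lia.
  by rewrite mulr1 mul1r rmorphD opprD addrNK.
Qed.

Fact shriek_rel s u : weyl_rel s u -> act shriek_act s =1 act shriek_act u.
Proof.
case=> w; apply: fs_coef_inj => n.
change (shriek_alpha (n - 1) *
    (shriek_beta (n - 1 + 1) * fs_coef w (n - 1 + 1)) =
  shriek_beta (n + 1) * (shriek_alpha (n + 1 - 1) * fs_coef w (n + 1 - 1)) +
  1 * fs_coef w n).
by rewrite subrK addrK !mulrA shriek_coef_rel mulrDl.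
Qed.

Definition shriek_mod : rmodType (weyl k) := pmod shriek_rel.
Definition shriek_e (n : int) : shriek_mod := forms_e shriek_rel n.

Lemma shriek_basis : weyl_basis shriek_alpha shriek_beta shriek_e.
Proof.
split=> [|n|n]; first exact: pmod_graded_basis.
- have := @pmod_wshift _ _ _ _ shriek_rel Wt _ (-1) (fun=> erefl) n.
  by rewrite opprK addrK.
- have := @pmod_wshift _ _ _ _ shriek_rel Wd _ 1 (fun=> erefl) n.
  by rewrite subrK.
Qed.
End ShriekModel.

(** * Isomorphisms, and maps out of modules with a graded basis *)

Section MkLinear.
Variables (R : pzRingType) (U V : lmodType R) (f : U -> V).
Definition linear_fun_of (_ : linear f) : U -> V := f.
Variable fl : linear f.
HB.instance Definition _ := GRing.isLinear.Build R U V _ (linear_fun_of fl) fl.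
Definition mk_linear : {linear U -> V} := linear_fun_of fl.
End MkLinear.

Section ResMap.
Variables (R S : pzRingType) (r : {rmorphism R -> S}) (M N : lmodType S).

Lemma res_iso : mod_iso M N -> mod_iso (res r M) (res r N).
Proof.
move=> [f f_bij].
have fl : linear (f : res r M -> res r N) by move=> a u v; exact: (linearP f).
by exists (mk_linear fl).
Qed.
End ResMap.

Section ModIso.
Variable R : pzRingType.
Implicit Types M N P : lmodType R.

Lemma mod_iso_trans M N P : mod_iso M N -> mod_iso N P -> mod_iso M P.
Proof.
move=> [f fb] [g gb].
have gfl : linear (g \o f) by move=> a u v; rewrite /= !linearP.
by exists (mk_linear gfl); exact: bij_comp.
Qed.

Lemma cyclic_mod_iso M N (m0 : M) (n0 : N) I J :
  (forall p, I p <-> J p) -> cyclic_mod m0 I -> cyclic_mod n0 J -> mod_iso M N.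
Proof.
move=> IJ Mc [gen ann].
have Nc : cyclic_mod n0 I by split=> // p; rewrite IJ.
by have [f [fb _]] := cyclic_iso Mc Nc; exists f.
Qed.
End ModIso.

Section GradedMap.
Variables (k : fieldType) (I : Type) (rel : expr k I -> expr k I -> Prop).
Local Notation A := (palg rel).
Local Notation cst := (pcst rel).

Lemma graded_ind (M : rmodType A) (e : int -> M) (P : M -> Prop) :
  graded_basis e -> P 0 -> (forall u v, P u -> P v -> P (u + v)) ->
  (forall c n, P ((cst c : A^c) *: e n)) -> forall u, P u.
Proof.
move=> [coord Mc] P0 PD Pe u; rewrite (coord_decomp Mc u).
by apply: big_ind.
Qed.

(** The [k]-linear extension of [e n |-> g n] commutes with the generators, hence with the whole
    algebra by induction on its elements. The vectors [g n] may vanish, as some do in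
    [truncation]. *)
Lemma graded_map (M N : rmodType A) (e : int -> M) (g : int -> N) :
  graded_basis e ->
  (forall i n, exists c n', (gen rel i : A^c) *: e n = (cst c : A^c) *: e n' /\
    (gen rel i : A^c) *: g n = (cst c : A^c) *: g n') ->
  exists phi : {linear M -> N}, forall n, phi (e n) = g n.
Proof.
move=> eb eg; have [coord Mc] := eb; have [_ coordP _] := Mc.
pose phi u := fs_ext (pcst_c rel) g (coord u).
have phi_e n : phi (e n) = g n.
  by rewrite /phi (coord_delta Mc); exact (fs_ext_delta (pcst_c rel) g n).
have phiP a u v : phi ((cst a : A^c) *: u + v) = (cst a : A^c) *: phi u + phi v.
  by rewrite /phi coordP; exact (fs_extP (pcst_c rel) g a (coord u) (coord v)).
have phiD u v : phi (u + v) = phi u + phi v.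
  by have := phiP 1 u v; rewrite rmorph1 !scale1r.
have phi0 : phi 0 = 0.
  by apply: (addIr (phi 0)); rewrite -phiD !add0r.
have phiZ c u : phi ((cst c : A^c) *: u) = (cst c : A^c) *: phi u.
  by have := phiP c u 0; rewrite !addr0 phi0 addr0.
have phiM : forall (p : A) u, phi ((p : A^c) *: u) = (p : A^c) *: phi u.
  apply: palg_ind => [i|c|p q IHp IHq|p IHp|p q IHp IHq] u.
  - move: u; apply: (graded_ind eb) => [|u v IHu IHv|c n].
    + by rewrite scaler0 phi0 scaler0.
    + by rewrite scalerDr !phiD IHu IHv scalerDr.
    + have [d [n' [Ee Eg]]] := eg i n.
      by rewrite rscaleC Ee !phiZ !phi_e [RHS]rscaleC Eg.
  - exact: phiZ.
  - by rewrite !rscaleD phiD IHp IHq.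
  - rewrite !rscaleN; apply: (addIr (phi ((p : A^c) *: u))).
    by rewrite -phiD IHp !addNr phi0.
  - by rewrite -!rscaleA IHq IHp.
have phil : linear (phi : M -> N) by move=> p u v; rewrite phiD phiM.
by exists (mk_linear phil) => n; exact: phi_e.
Qed.

Lemma graded_basis_transport (M N : rmodType A) (e : int -> M)
    (f : {linear M -> N}) :
  bijective f -> graded_basis e -> graded_basis (f \o e).
Proof.
move=> [f' fK f'K] [coord [coord_inj coordP coord_e]].
exists (coord \o f'); split=> [|a u v|n] /=.
- exact: inj_comp coord_inj (can_inj f'K).
- rewrite -coordP; congr coord.
  by rewrite -[in LHS](f'K u) -[in LHS](f'K v) -linearP fK.
- by rewrite fK coord_e.
Qed.

Lemma palg_tr_invol (tr : {rmorphism A -> A^c}) :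
  (forall i, tr (tr (gen rel i)) = gen rel i) ->
  (forall a, tr (cst a) = cst a) -> forall p, tr (tr p) = p.
Proof.
move=> trg trc.
apply: palg_ind => // [a|p q IHp IHq|p IHp|p q IHp IHq].
- by rewrite trc trc.
- by rewrite !antihomD IHp IHq.
- by rewrite !antihomN IHp.
- by rewrite !antihomM IHp IHq.
Qed.
End GradedMap.

Section Shriek.
Variable k : numFieldType.
Local Notation tcst := (pcst (@tweyl_rel k)).
Local Notation wcst := (pcst (@weyl_rel k)).
Local Notation twc := ((tweyl k)^c).
Local Notation wc := ((weyl k)^c).
Local Notation t := (W_t k).
Local Notation d := (W_d k).

Lemma tweyl_tr_d : tweyl_tr k (L_d k) = - L_d k :> tweyl k.
Proof. exact (palg_lift_gen (@tweyl_tr_central k) (@tweyl_tr_rel k) Ld). Qed.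
Lemma weyl_tr_t : weyl_tr k t = t :> weyl k.
Proof. exact (palg_lift_gen (@weyl_tr_central k) (@weyl_tr_rel k) Wt). Qed.
Lemma weyl_tr_d : weyl_tr k d = - d :> weyl k.
Proof. exact (palg_lift_gen (@weyl_tr_central k) (@weyl_tr_rel k) Wd). Qed.

Lemma tweyl_trK p : tweyl_tr k (tweyl_tr k p) = p.
Proof.
apply: palg_tr_invol => [i|a]; last first.
  exact (palg_lift_cst (@tweyl_tr_central k) (@tweyl_tr_rel k) a).
have gE j : tweyl_tr k (gen (@tweyl_rel k) j) = tweyl_tr_gen k j.
  exact (palg_lift_gen (@tweyl_tr_central k) (@tweyl_tr_rel k) j).
rewrite gE; case: i => /=; [exact: gE|exact: gE|].
by rewrite antihomN tweyl_tr_d opprK.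
Qed.

Lemma weyl_trK p : weyl_tr k (weyl_tr k p) = p.
Proof.
apply: palg_tr_invol => [i|a]; last first.
  exact (palg_lift_cst (@weyl_tr_central k) (@weyl_tr_rel k) a).
have gE j : weyl_tr k (gen (@weyl_rel k) j) = weyl_tr_gen k j.
  exact (palg_lift_gen (@weyl_tr_central k) (@weyl_tr_rel k) j).
rewrite gE; case: i => /=; first exact: gE.
by rewrite antihomN weyl_tr_d opprK.
Qed.

Lemma tweyl_basis_transport (M N : rmodType (tweyl k)) (e : int -> M)
    (f : {linear M -> N}) :
  bijective f -> tweyl_basis e -> tweyl_basis (f \o e).
Proof.
move=> f_bij [eb ex ey ed]; split=> [|n|n|n] /=.
- exact: graded_basis_transport.
- by rewrite -linearZZ ex.
- by rewrite -linearZZ ey.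
- by rewrite -linearZZ ed linearZZ.
Qed.

(** [Omega] is self-dual on C^*: the dual of [D/dD] is [D/(-d)D], and both signs give the same
    ideal. *)
Lemma dual_basis (M : rmodType (tweyl k)) (e : int -> M) : tweyl_basis e ->
  exists e' : int -> dual (tweyl_tr k) M, tweyl_basis e'.
Proof.
move=> eb; have Mc := tweyl_cyclic eb.
have [e0 Nc] := dual_cyclic tweyl_trK Mc (@tweyl_d_regular k).
have Nc' : cyclic_mod e0 (fun p => exists q, p = L_d k * q).
  split=> [|p]; first exact: Nc.1.
  rewrite Nc.2 tweyl_tr_d; split=> -[q ->]; exists (- q).
    by rewrite mulrN mulNr.
  by rewrite mulrN mulNr opprK.
have [f [f_bij _]] := cyclic_iso Mc Nc'.
by exists (f \o e); exact: tweyl_basis_transport.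
Qed.

(** Transposition reverses products, so [D/(td)D], generated by [e (-1)], has as dual the quotient
    of [D] by the ideal of [tr(td) = - dt]. In the model, [dt] kills [e 0] because
    [shriek_alpha (-1) = 0]. *)
Lemma dual_shriek_iso (M : rmodType (weyl k)) (e : int -> M) :
  weyl_basis (fun=> 1) (fun n => - n%:~R) e ->
  mod_iso (dual (weyl_tr k) M) (shriek_mod k).
Proof.
move=> eb; have [_ et ed] := eb.
have Mc : cyclic_mod (e (-1)) (fun p => exists q, p = (t * d + wcst 0) * q).
  apply: (weyl_cyclic eb) => [n _|n n1|]; first exact: oner_neq0.
    by rewrite oppr_eq0 intr_eq0; lia.
  rewrite rmorph0 addr0 -(rscaleA (M := M)) et rmorph1 scale1r ed oppr0.
  by rewrite rmorph0 scale0r.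
have reg c : (t * d + wcst 0) * c = 0 -> c = 0.
  rewrite rmorph0 addr0 -mulrA => /weyl_t_regular; exact: weyl_d_regular.
have [e0 Nc] := dual_cyclic weyl_trK Mc reg.
have trE : weyl_tr k (t * d + wcst 0) = - (t * d + wcst 1) :> weyl k.
  rewrite rmorph0 addr0 rmorph1 -weylE -mulNr -weyl_tr_d -{2}weyl_tr_t.
  by rewrite -antihomM.
have Sb := shriek_basis k; have [_ st sd] := Sb.
have Sc : cyclic_mod (shriek_e k 0)
    (fun p => exists q, p = (t * d + wcst 1) * q).
  apply: (weyl_cyclic Sb) => [n n0|n n0|].
  - by rewrite /shriek_alpha n0 oner_neq0.
  - by rewrite /shriek_beta ifF ?oner_neq0 //; lia.
  rewrite rmorph1 -weylE -(rscaleA (M := shriek_mod k)) sd rscaleC st.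
  have -> : shriek_alpha k (0 - 1) = 0.
    have neg : (0 <= 0 - 1 :> int) = false by lia.
    by rewrite /shriek_alpha neg subrK rmorph0 oppr0.
  by rewrite rmorph0 scale0r scaler0.
apply: cyclic_mod_iso Nc Sc => p; rewrite trE.
split=> -[q ->]; exists (- q); first by rewrite mulrN mulNr.
by rewrite mulrN mulNr opprK.
Qed.

Lemma jshriek_iso (r : {rmorphism weyl k -> tweyl k}) :
  standard_chart r ->
  mod_iso (jshriek r (Omega k)) (shriek_mod k).
Proof.
move=> rb; have [e eb] := dual_basis (Omega_basis k).
by have [e' eb'] := rb _ _ eb; exact: dual_shriek_iso eb'.
Qed.

(** * The restriction of j_! Omega to C^* *)

Section Gluing.
Variables (N M : rmodType (weyl k)) (e : int -> N) (e' : int -> M).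
Hypothesis Nb : weyl_basis (@shriek_alpha k) (@shriek_beta k) e.
Hypothesis Mb : weyl_basis (fun=> 1) (fun n => - n%:~R) e'.

(** Killing the [e n] with [n < 0] is compatible with the action because the boundary coefficients
    vanish: [t] kills [e (-1)] in the source and [d] kills [e' 0] in the target. Kernel and cokernel
    are [t]-torsion, so the map becomes an isomorphism on C^*. *)
Lemma truncation : exists phi : {linear N -> M},
  [/\ forall n, phi (e n) = if 0 <= n then e' n else 0,
      forall u, phi u = 0 -> exists i, (t ^+ i : wc) *: u = 0
    & forall v, exists u i, phi u = (t ^+ i : wc) *: v].
Proof.
have [Ng et ed] := Nb; have [Mg et' ed'] := Mb.
have [|phi phiE] :=
    @graded_map _ _ _ N M e (fun n => if 0 <= n then e' n else 0) Ng.
  case=> n.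
    exists (shriek_alpha k n), (n + 1); split; first exact: et.
    rewrite /shriek_alpha; case: ifP => [n0|/negbT n0].
      by rewrite et' ifT //; lia.
    case: ifP => n1; rewrite !scaler0 //.
    have -> : n + 1 = 0 by lia.
    by rewrite rmorph0 oppr0 rmorph0 scale0r.
  exists (shriek_beta k n), (n - 1); split; first exact: ed.
  have [n1|n1] := boolP (1 <= n).
    have -> : 0 <= n by lia.
    have -> : 0 <= n - 1 by lia.
    by rewrite ed' /shriek_beta n1.
  have -> : (0 <= n - 1) = false by lia.
  case: ifP => n0; rewrite scaler0 ?scaler0 //.
  have -> : n = 0 by lia.
  by rewrite ed' rmorph0 oppr0 rmorph0 scale0r.
have cst1 : wcst 1 = 1 by rewrite rmorph1.
have t_pow n i : (t ^+ i : wc) *: e' n = e' (n + i).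
  elim: i => [|i IHi]; first by rewrite expr0 scale1r addr0.
  rewrite exprSr -(rscaleA (M := M)) IHi et' cst1 scale1r.
  by congr e'; lia.
have t_nilp n : n < 0 -> exists i, (t ^+ i : wc) *: e n = 0.
  (* Powers of [t] climb from [e (- i - 1)] to a multiple of [e (-1)], which one more [t] kills. *)
  move=> n0; have [i nE] : exists i, n = - (i.+1%:Z) by exists `|n|%N.-1; lia.
  exists i.+1; rewrite {n0}nE; elim: i => [|i IHi].
    rewrite expr1 et; have -> : shriek_alpha k (- 1%:Z) = 0.
      by rewrite /shriek_alpha addNr rmorph0 oppr0.
    by rewrite rmorph0 scale0r.
  rewrite exprS -(rscaleA (M := N)) et rscaleC.
  have -> : - (i.+2%:Z) + 1 = - (i.+1%:Z) by lia.
  by rewrite IHi scaler0.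
exists phi; split=> // [u phi0|].
  have [coord Nc] := Ng; have [coord' Mc] := Mg.
  (* [phi] preserves the coordinates of index at least 0, so an element of its kernel is a
     combination of [e n] with [n < 0], each killed by a power of [t]. *)
  have phi_coef v n : 0 <= n ->
      fs_coef (coord' (phi v)) n = fs_coef (coord v) n.
    move=> n0; move: v; apply: (graded_ind Ng) => [|v w vE wE|c m].
    - by rewrite linear0 (coord_zero Nc) (coord_zero Mc).
    - by rewrite linearD (coordD Nc) (coordD Mc) !fs_coefD vE wE.
    rewrite linearZZ phiE (coordZ Nc) (coordZ Mc) !fs_coefZ (coord_delta Nc).
    case: ifP => m0; first by rewrite (coord_delta Mc).
    rewrite (coord_zero Mc) fs_coef0 fs_deltaE; case: eqP => // nm.
    by rewrite -nm n0 in m0.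
  pose K (v : N) := exists i, (t ^+ i : wc) *: v = 0.
  have KD v w : K v -> K w -> K (v + w).
    move=> [i iv] [j jw]; exists (i + j)%N; rewrite scalerDr.
    rewrite {1}exprD -(rscaleA (M := N)) iv scaler0 add0r.
    by rewrite addnC exprD -(rscaleA (M := N)) jw scaler0.
  rewrite (coord_decomp Nc u).
  apply: (big_ind K) => [|//|n _]; first by exists 0%N; rewrite scaler0.
  have [n0|/t_nilp[i ei]] := leP 0 n; last first.
    by exists i; rewrite rscaleC ei scaler0.
  exists 0%N; rewrite -phi_coef // phi0 (coord_zero Mc) fs_coef0.
  by rewrite rmorph0 scale0r scaler0.
apply: (graded_ind Mg).
- by exists 0, 0%N; rewrite linear0 scaler0.
- move=> v w [x [i xE]] [y [j yE]].
  exists ((t ^+ j : wc) *: x + (t ^+ i : wc) *: y), (i + j)%N.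
  rewrite linearD !linearZZ xE yE !(rscaleA (M := M)) -!exprD scalerDr.
  by rewrite (addnC j i).
- move=> c n.
  (* The power [t^|n|] moves the index [n] to [n + |n|], which is nonnegative and therefore reached
     by [phi]. *)
  exists ((wcst c : wc) *: e (n + `|n|%N)), `|n|%N.
  by rewrite linearZZ phiE rscaleC t_pow ifT //; lia.
Qed.
End Gluing.

(** Ensures that the statement about all gluings [rho] is not vacuous: [truncation], transported to
    [j_! Omega], is a gluing. *)
Lemma shriek_gluing_exists (r : {rmorphism weyl k -> tweyl k}) :
  standard_chart r ->
  inhabited (shriek_gluing r).
Proof.
move=> rb; have [f [g fK gK]] := jshriek_iso rb.
have [e' eb'] := rb _ _ (Omega_basis k).
have [phi [_ phi_ker phi_surj]] := truncation (shriek_basis k) eb'.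
have rhoP : linear (phi \o f) by move=> a u v; rewrite /= !linearP.
constructor; apply: (@RestrictionMap _ _ _ _ (mk_linear rhoP)) => [u|v].
  move=> /phi_ker[i iu]; exists i; apply: (can_inj fK).
  by rewrite linearZZ iu linear0.
have [u [i uE]] := phi_surj v; exists (g u), i.
exact (etrans (congr1 phi (gK u)) uE).
Qed.
End Shriek.

(** * Cohomology *)

(** Restricted to the kernel of [f], the linear map [p] is a bijection with inverse [s];
    surjectivity of [f] makes the cokernel zero. *)
Lemma kernel_iso (R : pzRingType) (U V W : lmodType R) (f : {linear U -> W})
    (p : {linear U -> V}) (s : V -> U) :
  (forall w, exists u, f u = w) -> (forall v, f (s v) = 0) -> cancel s p ->
  (forall u, f u = 0 -> p u = 0 -> u = 0) ->
  mod_iso (kernel f) V /\ (forall c : cokernel f, c = 0).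
Proof.
move=> f_surj fs sK inj; split; last first.
  move=> c; have [w <-] := quot_pi_surj c.
  rewrite -[RHS](linear0 (quot_pi _)); apply/quot_piE/asboolP; rewrite subr0.
  exact: f_surj.
have pl : linear (fun u : kernel f => p (sub_mod_val u)).
  by move=> a u v; rewrite /= linearP.
have kP v : s v \in GRing.SubmodClosed.clone R U (lin_ker f) _.
  exact/eqP/fs.
exists (mk_linear pl); exists (fun v => SubMod (kP v)) => [[u uk]|v].
  2: exact: sK.
apply: val_inj => /=; apply/eqP; rewrite -subr_eq0; apply/eqP/inj.
  by rewrite linearB fs sub0r; move/eqP: uk => /= ->; rewrite oppr0.
by rewrite linearB sK subrr.
Qed.

Section Cech.
Variables (k : comNzRingType) (lambda : int).
Variable F : glued_mod (chart_zt k lambda).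

(** Each section over C_x then has exactly one partner over C_z with the same restriction to C^*,
    and any section on C^* already comes from C_z. *)
Lemma cech_bij_z : bijective (restr_z F) ->
  mod_iso (H0 F) (cech_x F) /\ (forall c : H1 F, c = 0).
Proof.
move=> [g gK Kg].
have pl : linear (fst : (cech_x F * cech_z F)%type -> cech_x F) by [].
apply: (@kernel_iso _ _ _ _ (cech_diff F) (mk_linear pl)
  (fun u => (u, g (restr_x F u)))).
- move=> w; exists (0, g (- (w : sec_xz F))).
  apply: etrans (cech_diffE _ _) _.
  by rewrite (linear0 (restr_x F)) Kg sub0r opprK.
- by move=> u; apply: etrans (cech_diffE _ _) _; rewrite Kg subrr.
- by [].
move=> [u v] uv u0; move: uv; rewrite [u]u0 => uv.
congr (_, _); apply: (can_inj gK).
have := etrans (esym (cech_diffE _ _)) uv.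
by rewrite !linear0 sub0r => /eqP; rewrite oppr_eq0 => /eqP.
Qed.

Lemma cech_bij_x : bijective (restr_x F) ->
  mod_iso (H0 F) (cech_z F) /\ (forall c : H1 F, c = 0).
Proof.
move=> [g gK Kg].
have pl : linear (snd : (cech_x F * cech_z F)%type -> cech_z F) by [].
apply: (@kernel_iso _ _ _ _ (cech_diff F) (mk_linear pl)
  (fun u => (g (restr_z F u), u))).
- move=> w; exists (g (w : sec_xz F), 0).
  apply: etrans (cech_diffE _ _) _.
  by rewrite (linear0 (restr_z F)); exact: etrans (subr0 _) (Kg w).
- by move=> u; apply: etrans (cech_diffE _ _) _; rewrite Kg subrr.
- by [].
move=> [u v] uv v0; move: uv; rewrite [v]v0 => uv.
congr (_, _); apply: (can_inj gK).
have := etrans (esym (cech_diffE _ _)) uv.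
rewrite (linear0 (restr_z F)) (linear0 (restr_x F)).
by move=> /(etrans (esym (subr0 _))).
Qed.
End Cech.

(** * R(lambda, alpha) as a cyclic module *)

Lemma quot_regular_cyclic (R : pzRingType) (N : submodClosed R^o) :
  cyclic_mod (quot_pi N (1 : R^o) : quot_mod N) (fun p : R => (p : R^o) \in N).
Proof.
have piE (p : R) :
    p *: (quot_pi N (1 : R^o) : quot_mod N) = quot_pi N (p : R^o).
  apply: etrans (esym (quot_piZ _ _ _)) _; congr (quot_pi _ _).
  exact: (mulr1 p).
split=> [q|p]; first by have [p <-] := quot_pi_surj q; exists p; rewrite piE.
by rewrite piE -[0 in X in X <-> _](linear0 (quot_pi N)) quot_piE subr0.
Qed.

Lemma span_ann (R : pzRingType) (S : set R^o) (M : lmodType R) (m : M) :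
  (forall s : R, S s -> s *: m = 0) ->
  forall p : R, (p : R^o) \in span_mod S -> p *: m = 0.
Proof.
move=> Sm p /asboolP pS.
have fl : linear (fun q : R^o => (q : R) *: m).
  by move=> a u v; rewrite scalerDl -scalerA.
have := pS (GRing.SubmodClosed.clone R R^o (lin_ker (mk_linear fl)) _).
by move=> /(_ (fun s Ss => introT eqP (Sm s Ss))) /eqP.
Qed.

Lemma span_mem (R : pzRingType) (V : lmodType R) (S : set V) x :
  S x -> x \in span_mod S.
Proof. by move=> Sx; apply/asboolP => N; exact. Qed.

Section Rmod.
Variables (k : fieldType) (lambda : int) (alpha : k).

Definition R_ideal (p : Usl2 k) : Prop :=
  (p : ((Usl2 k)^c)^o) \in span_mod (R_rels lambda alpha).

Lemma Rmod_cyclic : exists m : Rmod lambda alpha, cyclic_mod m R_ideal.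
Proof.
exists (quot_pi (span_mod (R_rels lambda alpha)) (1 : ((Usl2 k)^c)^o)).
exact: quot_regular_cyclic.
Qed.

Lemma R_ideal_right : right_ideal (rel := @sl2_rel k) R_ideal.
Proof.
split=> [|p q|p q]; first exact: rpred0.
  exact: rpredD.
move=> Rp.
exact: (rpredZ (s := span_mod (R_rels lambda alpha)) (q : (Usl2 k)^c)).
Qed.

Lemma R_ideal_h : R_ideal (R_rel_h lambda alpha).
Proof. by apply: span_mem; left. Qed.

Lemma R_ideal_ef : R_ideal (R_rel_ef lambda alpha).
Proof. by apply: span_mem; right. Qed.

Lemma R_ideal_ann (M : rmodType (Usl2 k)) (m : M) :
  ((R_rel_h lambda alpha) : (Usl2 k)^c) *: m = 0 ->
  ((R_rel_ef lambda alpha) : (Usl2 k)^c) *: m = 0 ->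
  forall p, R_ideal p -> (p : (Usl2 k)^c) *: m = 0.
Proof. by move=> hm efm p; apply: (@span_ann (Usl2 k)^c) => s [->|->]. Qed.
End Rmod.

(** * The modules R(lambda, alpha) *)

Section WeightStep.
Variables (k : fieldType) (I : Type) (rel : expr k I -> expr k I -> Prop).
Local Notation A := (palg rel).
Local Notation cst := (pcst rel).
Variable J : A -> Prop.
Hypothesis J_ideal : right_ideal J.

(** Moving [h] to the left across [a^n] costs [- n s]. On the left it can be replaced by [c], since
    [J] is stable under right multiplication. *)
Lemma weight_pow (a h : A) (s c : k) n : h * a = a * h + cst s * a ->
  J (h - cst c) -> J (a ^+ n * h - cst (c - n%:R * s) * a ^+ n).
Proof.
move=> ha Jh; have [_ _ JM] := J_ideal.
have -> : a ^+ n * h = h * a ^+ n - cst (n%:R * s) * a ^+ n.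
  elim: n => [|n IHn].
    by rewrite expr0 mulr1 mul1r mul0r rmorph0 mul0r subr0.
  have -> : a ^+ n.+1 * h = a ^+ n * h * a - cst s * a ^+ n.+1.
    rewrite exprSr -mulrA -(mulrA _ h) ha mulrDr [X in _ + X - _]mulrA.
    by rewrite -pcstC -mulrA addrK mulrA.
  rewrite IHn mulrBl -!mulrA -!exprSr -addrA -opprD -mulrDl -rmorphD.
  by rewrite -natr1 mulrDl mul1r.
have -> : h * a ^+ n - cst (n%:R * s) * a ^+ n - cst (c - n%:R * s) * a ^+ n =
    (h - cst c) * a ^+ n.
  by rewrite rmorphB !mulrBl opprB addrA subrK.
exact: JM.
Qed.

(** In [a^(n+2) b = (a^(n+1) b) a + s' a^(n+1) h], the first term is reduced by induction and the
    second by [weight_pow]. *)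
Lemma weight_step (a b h : A) (s s' c c1 : k) n : h * a = a * h + cst s * a ->
  a * b - b * a = cst s' * h -> J (h - cst c) -> J (a * b - cst c1) ->
  exists c', J (a ^+ n.+1 * b - cst c' * a ^+ n).
Proof.
move=> ha ab Jh Jab; have [_ JD JM] := J_ideal.
have Jcst x p : J p -> J (cst x * p) by rewrite pcstC; exact: JM.
elim: n => [|n [c' IHn]]; first by exists c1; rewrite expr1 expr0 mulr1.
exists (c' + s' * (c - n.+1%:R * s)).
have := JD _ _ (JM _ a IHn) (Jcst s' _ (weight_pow n.+1 ha Jh)).
congr J; rewrite mulrBl mulrBr addrACA -opprD; congr (_ - _).
  rewrite [in RHS]exprSr -[in RHS]mulrA -(subrK (b * a) (a * b)) ab addrC.
  by rewrite mulrDr !mulrA (pcstC s' (a ^+ n.+1)).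
by rewrite -mulrA -exprSr mulrA -rmorphM -mulrDl -rmorphD.
Qed.
End WeightStep.

Section BipowWeight.
Variables (k : fieldType) (I : Type) (rel : expr k I -> expr k I -> Prop).
Local Notation A := (palg rel).
Local Notation cst := (pcst rel).
Variables (J : A -> Prop) (a b h : A) (s s' c c1 c2 : k).
Hypothesis J_ideal : right_ideal J.
Hypothesis ha : h * a = a * h + cst s * a.
Hypothesis hb : h * b = b * h + cst (- s) * b.
Hypothesis ab : a * b - b * a = cst s' * h.
Hypotheses (Jh : J (h - cst c)).
Hypotheses (Jab : J (a * b - cst c1)) (Jba : J (b * a - cst c2)).

Lemma bipowN (x y : A) n : bipow x y (- n%:Z) = y ^+ n.
Proof. by case: n. Qed.

(** Supplies the reduction required by [graded_cyclic]. The negative half is the positive half with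
    [a] and [b] exchanged and the signs of [s] and [s'] changed. *)
Lemma bipow_weight g j : g = a \/ g = b \/ g = h ->
  exists c' j', J (bipow a b j * g - cst c' * bipow a b j').
Proof.
have [J0 _ _] := J_ideal.
have ba : b * a - a * b = cst (- s') * h by rewrite rmorphN mulNr -ab opprB.
have Jeq p q : p = q -> J (p - q) by move=> ->; rewrite subrr.
case: j => n [->|[->|->]] /=.
- by exists 1, n.+1; apply: Jeq; rewrite rmorph1 mul1r /= exprSr.
- case: n => [|n].
    by exists 1, (-1); apply: Jeq; rewrite rmorph1 expr0 !mul1r.
  have [c' Jc'] := weight_step J_ideal n ha ab Jh Jab.
  by exists c', n.
- by exists (c - n%:R * s), n; exact: weight_pow ha Jh.
- have [c' Jc'] := weight_step J_ideal n hb ba Jh Jba.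
  by exists c', (- n%:Z); rewrite bipowN.
- by exists 1, (Negz n.+1); apply: Jeq; rewrite rmorph1 mul1r /= [RHS]exprSr.
- by exists (c - n.+1%:R * - s), (Negz n); exact: weight_pow hb Jh.
Qed.
End BipowWeight.

Section Sl2.
Variable k : numFieldType.
Local Notation wcst := (pcst (@weyl_rel k)).
Local Notation ucst := (pcst (@sl2_rel k)).
Local Notation wc := ((weyl k)^c).
Local Notation uc := ((Usl2 k)^c).
Local Notation t := (W_t k).
Local Notation d := (W_d k).
Local Notation "'Ue'" := (U_e k).
Local Notation "'Uf'" := (U_f k).
Local Notation "'Uh'" := (U_h k).

Lemma Usl2_ef : Ue * Uf - Uf * Ue = Uh.
Proof.
by have := palg_rel (@sl2_ef k); rewrite pclass_add pclass_opp !pclass_mul.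
Qed.

Lemma Usl2_he : Uh * Ue = Ue * Uh + ucst 2%:R * Ue.
Proof.
have := palg_rel (@sl2_he k); rewrite pclass_add pclass_opp !pclass_mul => E.
by rewrite [RHS]addrC -[X in X + _]E subrK.
Qed.

Lemma Usl2_hf : Uh * Uf = Uf * Uh + ucst (- 2%:R) * Uf.
Proof.
have := palg_rel (@sl2_hf k); rewrite pclass_add !pclass_opp !pclass_mul => E.
by rewrite [RHS]addrC rmorphN mulNr -[X in X + _]E subrK.
Qed.

Section RmodIso.
Variables (M : rmodType (Usl2 k)) (e : int -> M) (m lambda : int) (alpha : k).
Hypothesis Me : graded_basis (rel := @sl2_rel k) e.
Hypothesis e_h : (R_rel_h lambda alpha : uc) *: e m = 0.
Hypothesis e_ef : (R_rel_ef lambda alpha : uc) *: e m = 0.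
Let J : Usl2 k -> Prop := R_ideal lambda alpha.

Let J_h : J (Uh - ucst (- (2%:R * alpha + lambda%:~R))).
Proof. by rewrite rmorphN opprK; exact: R_ideal_h. Qed.

Let J_ef : J (Ue * Uf - ucst (- ((alpha + lambda%:~R) * (alpha + 1)))).
Proof. by rewrite rmorphN opprK; exact: R_ideal_ef. Qed.

(** [fe = ef - h] is a difference of two elements that are scalars modulo [J]. Both orders of the
    product occur in [bipow_weight]. *)
Let J_fe : exists c, J (Uf * Ue - ucst c).
Proof.
have [_ JD JM] := R_ideal_right lambda alpha.
have JN p : J p -> J (- p) by rewrite -mulrN1; exact: JM.
have J_ef' := J_ef; have J_h' := J_h.
set x := - (_ * _) in J_ef'; set y := - (_ + _) in J_h'; exists (x - y).
have -> : Uf * Ue - ucst (x - y) = (Ue * Uf - ucst x) - (Uh - ucst y).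
  have -> : ucst (x - y) = ucst x - ucst y by rewrite rmorphB.
  rewrite -Usl2_ef; move: (Ue * Uf) (Uf * Ue) (ucst x) (ucst y) => p q X Y.
  rewrite opprB (opprD (p - q)) (opprB p q) opprK addrACA (addrC p) subrK.
  by rewrite (addrC Y).
exact: JD J_ef' (JN _ J_h').
Qed.

(** The case of C_x, where [f] raises the index and [e] lowers it; on C_z, [Rmod_iso_ef] applies
    instead. *)
Lemma Rmod_iso_fe :
  (forall n : int, m <= n -> exists2 c : k, c != 0 &
    (Uf : uc) *: e n = (ucst c : uc) *: e (n + 1)) ->
  (forall n : int, n <= m -> exists2 c : k, c != 0 &
    (Ue : uc) *: e n = (ucst c : uc) *: e (n - 1)) ->
  mod_iso M (Rmod lambda alpha).
Proof.
move=> f_step e_step; have [c Jc] := J_fe.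
have [v Rc] := Rmod_cyclic lambda alpha.
suff Mc : cyclic_mod (e m) (R_ideal lambda alpha).
  by have [f [f_bij _]] := cyclic_iso Mc Rc; exists f.
apply: (graded_cyclic (R_ideal_right lambda alpha) _ f_step e_step _ Me).
  exact: R_ideal_ann.
move=> i j.
have fe : Uf * Ue - Ue * Uf = ucst (- 1) * Uh.
  by rewrite rmorphN rmorph1 mulN1r -Usl2_ef opprB.
have he : Uh * Ue = Ue * Uh + ucst (- - 2%:R) * Ue by rewrite opprK Usl2_he.
apply: (bipow_weight (R_ideal_right lambda alpha)
  Usl2_hf he fe J_h Jc J_ef).
by case: i; [right; left|right; right|left].
Qed.

Lemma Rmod_iso_ef :
  (forall n : int, m <= n -> exists2 c : k, c != 0 &
    (Ue : uc) *: e n = (ucst c : uc) *: e (n + 1)) ->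
  (forall n : int, n <= m -> exists2 c : k, c != 0 &
    (Uf : uc) *: e n = (ucst c : uc) *: e (n - 1)) ->
  mod_iso M (Rmod lambda alpha).
Proof.
move=> e_step f_step; have [c Jc] := J_fe.
have [v Rc] := Rmod_cyclic lambda alpha.
suff Mc : cyclic_mod (e m) (R_ideal lambda alpha).
  by have [f [f_bij _]] := cyclic_iso Mc Rc; exists f.
apply: (graded_cyclic (R_ideal_right lambda alpha) _ e_step f_step _ Me).
  exact: R_ideal_ann.
move=> i j.
have ef : Ue * Uf - Uf * Ue = ucst 1 * Uh by rewrite rmorph1 mul1r Usl2_ef.
apply: (bipow_weight (R_ideal_right lambda alpha)
  Usl2_he Usl2_hf ef J_h J_ef Jc).
by case: i; [left|right; right|right; left].
Qed.
End RmodIso.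
End Sl2.

(** * The action of sl_2 on the model of j_! Omega *)

Section ShriekSl2.
Variable k : numFieldType.
Local Notation wcst := (pcst (@weyl_rel k)).
Local Notation ucst := (pcst (@sl2_rel k)).
Local Notation wc := ((weyl k)^c).
Local Notation uc := ((Usl2 k)^c).
Local Notation t := (W_t k).
Local Notation d := (W_d k).
Local Notation alpha := (@shriek_alpha k).
Local Notation beta := (@shriek_beta k).
Variables (N : rmodType (weyl k)) (e : int -> N).
Hypothesis Nb : weyl_basis alpha beta e.

(** The eigenvalue of [td] on [e n]: the sign of [n] affects the normalization of the basis, but not
    this product. *)
Lemma shriek_alpha_beta n : alpha n * beta (n + 1) = - (n + 1)%:~R.
Proof.
rewrite /shriek_alpha /shriek_beta; have [n0|n0] := boolP (0 <= n).
  have -> : 1 <= n + 1 by lia.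
  by rewrite mul1r.
have -> : (1 <= n + 1) = false by lia.
by rewrite mulr1.
Qed.

Lemma shriek_td n :
  ((t * d : weyl k) : wc) *: e n = (wcst (- (n + 1)%:~R) : wc) *: e n.
Proof.
have [_ et ed] := Nb.
rewrite -(rscaleA (M := N)) et rscaleC ed rscaleA -rmorphM mulrC addrK.
by rewrite shriek_alpha_beta.
Qed.

(** This operator is [f] on C_x and [e] on C_z. Written as [- t (td + lambda)], it first moves to
    [e (n + 1)], where [td] has eigenvalue [-(n + 2)]. *)
Lemma shriek_raise (lambda n : int) :
  ((- (t * t * d) - lambda%:~R * t : weyl k) : wc) *: e n =
  (wcst (alpha n * (n + 2 - lambda)%:~R) : wc) *: e (n + 1).
Proof.
have [_ et ed] := Nb.
have -> : - (t * t * d) - lambda%:~R * t = - (t * (t * d + wcst lambda%:~R)).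
  by rewrite mulrDr mulrA opprD rmorph_int mulrzr mulrzl.
rewrite (rscaleN (M := N)) -(rscaleA (M := N)) et rscaleC rscaleD shriek_td.
rewrite -rscaleD -rmorphD rscaleA -rmorphM -(rscaleN (M := N)) -rmorphN.
congr (_ *: _); congr wcst; rewrite -mulNr opprD opprK mulrC; congr (_ * _).
by rewrite -rmorphB; congr (_%:~R); ring.
Qed.

Lemma shriek_weight (lambda n : int) :
  (((t * d) *+ 2 + lambda%:~R : weyl k) : wc) *: e n =
  (wcst (lambda - 2 * (n + 1))%:~R : wc) *: e n.
Proof.
have -> : (t * d) *+ 2 + lambda%:~R = t * d * wcst 2 + wcst lambda%:~R.
  by rewrite rmorph_nat rmorph_int mulr_natr.
rewrite rscaleD -(rscaleA (M := N)) shriek_td !rscaleA -rscaleD -rmorphM.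
rewrite -rmorphD; congr (_ *: _); congr wcst.
by rewrite mulNr addrC rmorphB rmorphM mulrC.
Qed.

Section Res.
Variables (lambda : int) (r : {rmorphism Usl2 k -> weyl k}).
Local Notation M := (res (conv_hom r) N).

Lemma res_step (u : Usl2 k) (n n' : int) (c : k) :
  (forall a, r (ucst a) = wcst a) ->
  (r u : wc) *: e n = (wcst c : wc) *: e n' ->
  (u : uc) *: (e n : M) = (ucst c : uc) *: (e n' : M).
Proof. by move=> rc; rewrite -rc. Qed.

End Res.

Lemma beta_neq0 n : beta n != 0.
Proof.
rewrite /shriek_beta; case: ifP => n1; last exact: oner_neq0.
by rewrite oppr_eq0 intr_eq0; lia.
Qed.

Lemma raise_neq0 (lambda m n : int) : 0 <= m -> lambda - 1 <= m -> m <= n ->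
  alpha n * (n + 2 - lambda)%:~R != 0.
Proof.
move=> m0 ml mn; rewrite /shriek_alpha ifT; last by lia.
by rewrite mul1r intr_eq0; lia.
Qed.

Lemma shriek_Rmod_x (lambda a : int) : range_lt lambda a ->
  mod_iso (res (conv_hom (sl2_x k lambda)) N) (Rmod lambda (a%:~R : k)).
Proof.
move=> a_range.
have [m0 ml] : 0 <= - a - 1 /\ lambda - 1 <= - a - 1.
  by move: a_range; rewrite /range_lt; case: ifP; lia.
have rc := @sl2_x_cst k lambda; have [eb et ed] := Nb.
have e_step n := res_step rc (etrans (congr1 (fun u : weyl k => (u : wc) *: e n)
  (@sl2_x_genE k lambda Se)) (ed n)).
have f_step n := res_step rc (etrans (congr1 (fun u : weyl k => (u : wc) *: e n)
  (@sl2_x_genE k lambda Sf)) (shriek_raise lambda n)).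
pose M := res (conv_hom (sl2_x k lambda)) N.
have h_step n : (U_h k : uc) *: (e n : M) =
    (ucst (2 * (n + 1) - lambda)%:~R : uc) *: (e n : M).
  apply: (res_step rc); rewrite sl2_x_genE /=.
  have -> : - (t * d) *+ 2 - lambda%:~R = - ((t * d) *+ 2 + lambda%:~R).
    by rewrite opprD mulNrn.
  rewrite rscaleN shriek_weight -rscaleN -!rmorphN; congr (_ *: _); congr wcst.
  by congr (_%:~R); ring.
apply: (Rmod_iso_fe (m := - a - 1) (graded_basis_res rc eb)).
- rewrite /R_rel_h rscaleD h_step -rscaleD -rmorphD.
  rewrite (_ : _ + _ = 0) ?rmorph0 ?scale0r //; ring.
(* With [m = -a-1], [e] lowers [e m] and [f] raises it back, with total factor [alpha (m-1) * beta m
   * (m+1-lambda) = -(a+1)(a+lambda)]. *)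
- rewrite /R_rel_ef rscaleD -rscaleA e_step rscaleC f_step rscaleA.
  rewrite -rmorphM subrK -rscaleD -rmorphD (_ : _ + _ = 0) ?rmorph0 ?scale0r //.
  have := shriek_alpha_beta (- a - 1 - 1); rewrite subrK mulrAC => ->.
  ring.
- by move=> n mn; eexists; last exact: f_step; exact: raise_neq0 mn.
- by move=> n _; exists (beta n); [exact: beta_neq0|exact: e_step].
Qed.

Lemma shriek_Rmod_z (lambda a : int) : range_gt lambda a ->
  mod_iso (res (conv_hom (sl2_z k lambda)) N) (Rmod lambda (a%:~R : k)).
Proof.
move=> a_range.
have [m0 ml] : 0 <= a + lambda - 1 /\ lambda - 1 <= a + lambda - 1.
  by move: a_range; rewrite /range_gt; case: ifP; lia.
have rc := @sl2_z_cst k lambda; have [eb et ed] := Nb.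
have e_step n := res_step rc (etrans (congr1 (fun u : weyl k => (u : wc) *: e n)
  (@sl2_z_genE k lambda Se)) (shriek_raise lambda n)).
have f_step n := res_step rc (etrans (congr1 (fun u : weyl k => (u : wc) *: e n)
  (@sl2_z_genE k lambda Sf)) (ed n)).
have h_step n := res_step rc (etrans (congr1 (fun u : weyl k => (u : wc) *: e n)
  (@sl2_z_genE k lambda Sh)) (shriek_weight lambda n)).
apply: (Rmod_iso_ef (m := a + lambda - 1) (graded_basis_res rc eb)).
- rewrite /R_rel_h rscaleD h_step -rscaleD -rmorphD.
  rewrite (_ : _ + _ = 0) ?rmorph0 ?scale0r //; ring.
(* With [m = a+lambda-1], [e] raises [e m] and [f] lowers it back, with total factor
   [-(m+1)(m+2-lambda) = -(a+lambda)(a+1)]. *)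
- rewrite /R_rel_ef rscaleD -rscaleA e_step rscaleC f_step rscaleA.
  rewrite -rmorphM addrK -rscaleD -rmorphD (_ : _ + _ = 0) ?rmorph0 ?scale0r //.
  have := shriek_alpha_beta (a + lambda - 1); rewrite subrK mulrC mulrA => ->.
  ring.
- by move=> n mn; eexists; last exact: e_step; exact: raise_neq0 mn.
- by move=> n _; exists (beta n); [exact: beta_neq0|exact: f_step].
Qed.
End ShriekSl2.

(** * Cohomology of the two glued modules *)

Section Main.
Variables (k : numFieldType) (lambda : int).

(** On C_z the restriction map is the identity of [Omega] followed by the invertible operator
    [x^lambda]. *)
Lemma twist_jdot_bij (rho : shriek_gluing (chart_x k)) :
  bijective (restr_z (twist lambda (jshriekx_dotz rho))).
Proof.
exists (fun m : Omega k => (L_xpow k (- lambda) : (tweyl k)^c) *: m) => m.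
  exact: (twistVK (M := jshriekx_dotz rho) lambda m).
exact: (twistK (M := jshriekx_dotz rho) lambda m).
Qed.

(** [H0] is identified with the sections over C_x, which are the same module for every gluing
    [rho]. *)
Lemma jshriekx_dotz_cohomology (rho : shriek_gluing (chart_x k)) :
  (forall a : int, range_lt lambda a ->
     mod_iso (H0 (twist lambda (jshriekx_dotz rho)))
             (Rmod lambda (a%:~R : k))) /\
  (forall c : H1 (twist lambda (jshriekx_dotz rho)), c = 0).
Proof.
have [H0x H1x] := cech_bij_z (twist_jdot_bij rho); split=> // a a_range.
have N_iso := res_iso (conv_hom (sl2_x k lambda))
  (jshriek_iso (@chart_x_standard k)).
apply: mod_iso_trans H0x _.
exact: mod_iso_trans N_iso (shriek_Rmod_x (shriek_basis k) a_range).
Qed.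

Lemma jdotx_shriekz_cohomology (rho : shriek_gluing (chart_z k)) :
  (forall a : int, range_gt lambda a ->
     mod_iso (H0 (twist lambda (jdotx_shriekz rho)))
             (Rmod lambda (a%:~R : k))) /\
  (forall c : H1 (twist lambda (jdotx_shriekz rho)), c = 0).
Proof.
have bij : bijective (restr_x (twist lambda (jdotx_shriekz rho))) by exists id.
have [H0z H1z] := cech_bij_x bij; split=> // a a_range.
have N_iso := res_iso (conv_hom (sl2_z k lambda))
  (jshriek_iso (@chart_z_standard k)).
apply: mod_iso_trans H0z _.
exact: mod_iso_trans N_iso (shriek_Rmod_z (shriek_basis k) a_range).
Qed.
End Main.

Theorem theorem5p5 (R : realType) (lambda : int) :
  (inhabited (shriek_gluing (chart_x R[i])) /\
   forall rho : shriek_gluing (chart_x R[i]),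
     (forall alpha : int, range_lt lambda alpha ->
        mod_iso (H0 (twist lambda (jshriekx_dotz rho)))
                (Rmod lambda (alpha%:~R : R[i]))) /\
     (forall c : H1 (twist lambda (jshriekx_dotz rho)), c = 0)) /\
  (inhabited (shriek_gluing (chart_z R[i])) /\
   forall rho : shriek_gluing (chart_z R[i]),
     (forall alpha : int, range_gt lambda alpha ->
        mod_iso (H0 (twist lambda (jdotx_shriekz rho)))
                (Rmod lambda (alpha%:~R : R[i]))) /\
     (forall c : H1 (twist lambda (jdotx_shriekz rho)), c = 0)).
Proof.
split; split.
- exact: (@shriek_gluing_exists R[i] _ (@chart_x_standard R[i])).
- exact: (@jshriekx_dotz_cohomology R[i]).
- exact: (@shriek_gluing_exists R[i] _ (@chart_z_standard R[i])).
- exact: (@jdotx_shriekz_cohomology R[i]).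
Qed.
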